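(* Suppose that $g$ is twice differentiable and that, for some $\xi_0\in\mathcal{P}$, $Z^{*}(\xi_0)\neq\emptyset$. Then, for $k\ge 0$ and $\bar z^k\in Z^{*}(\xi_k)$, if $\mathrm{P}(\xi_k)$ is strongly regular at $\bar z^k$, there exist neighborhoods $\mathcal{B}(\bar z^k,r_z)$ of $\bar z^k$ and $\mathcal{B}(\xi_k,r_\xi)$ of $\xi_k$ such that: (a) The set of KKT points $Z^{*}(\xi_{k+1})$ of $\mathrm{P}(\xi_{k+1})$ is nonempty for any $\xi_{k+1}\in\mathcal{B}(\xi_k,r_\xi)$. (b) If, in addition, there exists a constant $0\le\kappa<\frac{1}{2\gamma}$ such that $\|F'(\bar z^k)-\tilde F'_k\|\le\kappa$, then, for $z^k\in\mathcal{B}(\bar z^k,r_z)$ and $\xi_{k+1}\in\mathcal{B}(\xi_k,r_\xi)$, the subproblem $\mathrm{P}(z^k,A_k,H_k;\xi_{k+1})$ is uniquely solvable in the neighborhood $\mathcal{B}(\bar z^k,r_z)$ (i.e. it has exactly one KKT point there). (c) If, moreover, there exists a constant $0\le\omega<+\infty$ such that $\|F'(z)-F'(\bar z^k)\|\le\omega\|z-\bar z^k\|$ for all $z\in\mathcal{B}(\bar z^k,r_z)$, then the sequence $\{z^k\}_{k\ge0}$ generated by Algorithm APCSCP, where $z^k\in\mathcal{B}(\bar z^k,r_z)$ and $\xi_{k+1}\in\mathcal{B}(\xi_k,r_\xi)$, satisfies $$\|z^{k+1}-\bar z^{k+1}\|\le\left(\alpha+c_1\|z^k-\bar z^k\|\right)\|z^k-\bar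 z^k\|+\left(c_2+c_3\|\xi_{k+1}-\xi_k\|\right)\|\xi_{k+1}-\xi_k\|,$$ where $0\le\alpha<1$, $0\le c_i<+\infty$ $(i=1,2,3)$ and $c_2>0$ are constants, and $\bar z^{k+1}\in Z^{*}(\xi_{k+1})$.
   Context: Notation: $\|\cdot\|$ is the Euclidean norm (and the induced norm for matrices); $\mathcal{B}(x,r)$ is the open ball of radius $r$ centered at $x$; $\mathcal{S}^n_+$ is the set of real symmetric positive semidefinite $n\times n$ matrices; $g'$ is the Jacobian of $g$. Parametric problem. Let $c\in\mathbb{R}^n$, $g:\mathbb{R}^n\to\mathbb{R}^m$, $M\in\mathbb{R}^{m\times p}$, let $\Omega\subseteq\mathbb{R}^n$ be nonempty, closed and convex, and let $\mathcal{P}\subseteq\mathbb{R}^p$ be the parameter set. $\mathrm{P}(\xi)$ is: $\min_{x\in\mathbb{R}^n} c^Tx$ subject to $g(x)+M\xi=0$, $x\in\Omega$. Let $\mathcal{N}_\Omega(x)=\{u: u^T(x-v)\ge0\ \forall v\in\Omega\}$ if $x\in\Omega$ and $\emptyset$ otherwise be the normal cone. Put $K:=\Omega\times\mathbb{R}^m$, with normal cone $\mathcal{N}_K$, $z=(x,y)\in\mathbb{R}^{n}\times\mathbb{R}^m$, $$F(z):=\begin{pmatrix}c+g'(x)^Ty\\ g(x)\end{pmatrix},\qquad C:=\begin{bmatrix}0\\ M\end{bmatrix}.$$ A KKT point of $\mathrm{P}(\xi)$ is a $z$ with $0\in F(z)+C\xi+\mathcal{N}_K(z)$; $Z^{*}(\xi)$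 is the set of KKT points. Strong regularity. For $\bar z^k\in Z^{*}(\xi_k)$ put $L(z;\bar z^k,\xi_k):=F(\bar z^k)+F'(\bar z^k)(z-\bar z^k)+C\xi_k+\mathcal{N}_K(z)$ and $L^{-1}(\delta;\bar z^k,\xi_k):=\{z:\delta\in L(z;\bar z^k,\xi_k)\}$. $\mathrm{P}(\xi_k)$ is strongly regular at $\bar z^k$ if there are balls $\mathcal{B}(0,\bar r_\delta)$ and $\mathcal{B}(\bar z^k,\bar r_z)$ such that $z^*_k(\delta):=\mathcal{B}(\bar z^k,\bar r_z)\cap L^{-1}(\delta;\bar z^k,\xi_k)$ is single-valued and Lipschitz continuous on $\mathcal{B}(0,\bar r_\delta)$ with Lipschitz constant $0<\gamma<+\infty$. The constants $\gamma,\bar r_z,\bar r_\delta$ do not depend on $k$. Subproblem. Given $z^k=(x^k,y^k)\in\Omega\times\mathbb{R}^m$, $A_k\in\mathbb{R}^{m\times n}$, $H_k\in\mathcal{S}^n_+$, let $m^k:=(g'(x^k)-A_k)^Ty^k$. The convex subproblem $\mathrm{P}(z^k,A_k,H_k;\xi)$ is: $\min_x\{c^Tx+(m^k)^T(x-x^k)+\frac12(x-x^k)^TH_k(x-x^k)\}$ subject to $A_k(x-x^k)+g(x^k)+M\xi=0$, $x\in\Omega$. With $$\tilde F'_k:=\begin{bmatrix}H_k&A_k^T\\ A_k&0\end{bmatrix},$$ its KKT points are the $z$ with $0\in F(z^k)+\tilde F'_k(z-z^k)+C\xi+\mathcal{N}_K(z)$. The Slater condition $\mathrm{ri}(\Omega)\cap\{x: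 g(x^k)+A_k(x-x^k)+M\xi_{k+1}=0\}\ne\emptyset$ is assumed for the subproblems, so KKT points are exactly the pairs (solution, multiplier). Algorithm APCSCP. Start from $z^0=(x^0,y^0)$, an approximate KKT point of $\mathrm{P}(\xi_0)$, and matrices $A_0$ and $H_0\in\mathcal{S}^n_+$. At iteration $k=0,1,\dots$: get a new parameter $\xi_{k+1}\in\mathcal{P}$; let $z^{k+1}=(x^{k+1},y^{k+1})$ be the solution and the corresponding multiplier of $\mathrm{P}(z^k,A_k,H_k;\xi_{k+1})$; choose new matrices $A_{k+1}$ and $H_{k+1}\in\mathcal{S}^n_+$. Convention: $\bar z^{k+1}$ denotes the unique point of $Z^{*}(\xi_{k+1})\cap\mathcal{B}(\bar z^k,r_z)$, for the radii $r_z,r_\xi$ under consideration and $\xi_{k+1}\in\mathcal{B}(\xi_k,r_\xi)$. *)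

(* Defs.v *)
From HB Require Import structures.
From mathcomp Require Import all_boot all_order all_algebra.
From mathcomp Require Import all_classical all_reals all_analysis.

Set Implicit Arguments.
Unset Strict Implicit.
Unset Printing Implicit Defensive.

Import Order.TTheory GRing.Theory Num.Theory.
Import numFieldNormedType.Exports.

Local Open Scope classical_set_scope.
Local Open Scope ring_scope.

(* The library's norm on matrices is the maximum norm. It is used below only  *)
(* through its topology (closed, differentiable); every norm and every ball   *)
(* of the problem is Euclidean.                                               *)
Section Euclidean.
Context {R : realType}.

Definition dotp {n} (u v : 'cV[R]_n) : R := \sum_(i < n) u i 0 * v i 0.

Definition enorm {n} (u : 'cV[R]_n) : R := Num.sqrt (dotp u u).

Definition eball {n} (x : 'cV[R]_n) (r : R) : set 'cV[R]_n :=
  [set y | enorm (y - x) < r].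

Definition opnorm {m n} (A : 'M[R]_(m, n)) : R :=
  sup [set enorm (A *m v) | v in [set v : 'cV[R]_n | enorm v <= 1]].

Definition psd {n} (H : 'M[R]_n) : Prop :=
  H^T = H /\ forall v : 'cV[R]_n, 0 <= dotp v (H *m v).

(* The library's 'J is for maps between row vectors and acts on the right;    *)
(* this one is for column vectors, with 'd f x v = jac f x *m v.              *)
Definition jac {m n} (f : 'cV[R]_n -> 'cV[R]_m) (x : 'cV[R]_n) : 'M[R]_(m, n) :=
  \matrix_(i, j) ('d f x (delta_mx j 0) : 'cV[R]_m) i 0.

Definition twice_differentiable {m n} (g : 'cV[R]_n -> 'cV[R]_m) : Prop :=
  (forall x, differentiable g x) /\ (forall x, differentiable (jac g) x).

Definition affine_hull {n} (S : set 'cV[R]_n) : set 'cV[R]_n :=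
  [set x | exists (k : nat) (v : 'I_k -> 'cV[R]_n) (w : 'I_k -> R),
    [/\ forall i, S (v i), \sum_i w i = 1 & x = \sum_i w i *: v i]].

Definition rel_interior {n} (S : set 'cV[R]_n) : set 'cV[R]_n :=
  [set x | S x /\ exists2 e : R, 0 < e & eball x e `&` affine_hull S `<=` S].

Definition normal_cone {n} (S : set 'cV[R]_n) (x : 'cV[R]_n) : set 'cV[R]_n :=
  [set u | S x /\ forall v, S v -> 0 <= dotp u (x - v)].

Definition minimizers {n} (f : 'cV[R]_n -> R) (S : set 'cV[R]_n) :
    set 'cV[R]_n :=
  [set x | S x /\ forall v, S v -> f x <= f v].

End Euclidean.

(* A primal-dual point (x, y) is the column vector z = col_mx x y, so that    *)
(* x = usubmx z and y = dsubmx z.                                             *)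
Section ParametricProblem.
Context {R : realType} {n m p : nat}.
Variables (c : 'cV[R]_n) (g : 'cV[R]_n -> 'cV[R]_m) (M : 'M[R]_(m, p)).
Variable Omega : set 'cV[R]_n.

Definition coneK : set 'cV[R]_(n + m) := [set z | Omega (usubmx z)].

Definition kktF (z : 'cV[R]_(n + m)) : 'cV[R]_(n + m) :=
  col_mx (c + (jac g (usubmx z))^T *m dsubmx z) (g (usubmx z)).

Definition paramC : 'M[R]_(n + m, p) := col_mx 0 M.

Definition KKT (xi : 'cV[R]_p) : set 'cV[R]_(n + m) :=
  [set z | exists2 u, normal_cone coneK z u &
    0 = kktF z + paramC *m xi + u].

Definition Linv (xi : 'cV[R]_p) (zbar d : 'cV[R]_(n + m)) :
    set 'cV[R]_(n + m) :=
  [set z | exists2 u, normal_cone coneK z u &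
    d = kktF zbar + jac kktF zbar *m (z - zbar) + paramC *m xi + u].

Definition strongly_regular (gamma rbar_z rbar_delta : R)
    (xi : 'cV[R]_p) (zbar : 'cV[R]_(n + m)) : Prop :=
  [/\ 0 < gamma, 0 < rbar_z, 0 < rbar_delta &
    exists zstar : 'cV[R]_(n + m) -> 'cV[R]_(n + m),
      (forall d, eball 0 rbar_delta d ->
        eball zbar rbar_z `&` Linv xi zbar d = [set zstar d]) /\
      (forall d d', eball 0 rbar_delta d -> eball 0 rbar_delta d' ->
        enorm (zstar d - zstar d') <= gamma * enorm (d - d'))].

Section Subproblem.
Variables (zk : 'cV[R]_(n + m)) (A : 'M[R]_(m, n)) (H : 'M[R]_n).
Variable xi : 'cV[R]_p.

Let xk := usubmx zk.
Let yk := dsubmx zk.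

Definition sub_m : 'cV[R]_n := (jac g xk - A)^T *m yk.

Definition sub_objective (x : 'cV[R]_n) : R :=
  dotp c x + dotp sub_m (x - xk) + 2^-1 * dotp (x - xk) (H *m (x - xk)).

Definition sub_affine : set 'cV[R]_n :=
  [set x | A *m (x - xk) + g xk + M *m xi = 0].

Definition slater : Prop := rel_interior Omega `&` sub_affine !=set0.

Definition sub_solution : set 'cV[R]_n :=
  minimizers sub_objective (sub_affine `&` Omega).

Definition Ftilde' : 'M[R]_(n + m) := block_mx H A^T A 0.

Definition sub_KKT : set 'cV[R]_(n + m) :=
  [set z | exists2 u, normal_cone coneK z u &
    0 = kktF zk + Ftilde' *m (z - zk) + paramC *m xi + u].

Definition sub_solution_multiplier : set 'cV[R]_(n + m) :=
  [set z | sub_solution (usubmx z) /\ sub_KKT z].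

End Subproblem.

(* Iterations 0, ..., k of the algorithm, which produce z 1, ..., z k.+1; an  *)
(* infinite run is one that satisfies this for every k. No accuracy is        *)
(* prescribed for the approximate KKT point z 0.                              *)
Definition APCSCP (Par : set 'cV[R]_p) (k : nat) (xi : nat -> 'cV[R]_p)
    (z : nat -> 'cV[R]_(n + m)) (A : nat -> 'M[R]_(m, n))
    (H : nat -> 'M[R]_n) : Prop :=
  [/\ coneK (z 0%N),
      forall j, (j <= k.+1)%N -> Par (xi j),
      forall j, (j <= k)%N -> psd (H j) &
      forall j, (j <= k)%N ->
        sub_solution_multiplier (z j) (A j) (H j) (xi j.+1) (z j.+1)].

End ParametricProblem.

(* Main.v *)
Require Import Defs.
From HB Require Import structures.
From mathcomp Require Import all_boot all_order all_algebra.
From mathcomp Require Import all_classical all_reals all_analysis.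
From mathcomp Require Import ring lra.
Import Order.TTheory GRing.Theory Num.Theory.
Import numFieldNormedType.Exports.
Local Open Scope classical_set_scope.
Local Open Scope ring_scope.

(* A point z solves the generalized equation 0 \in G(z) + N_K(z) exactly when it
   is a fixed point of z |-> zstar (L(z) - G(z)), where L is the linearized KKT
   map at zbar and zstar the Lipschitz selection given by strong regularity.
   Only the differentiability of F at zbar is available in (a), where g'' need
   not be continuous, so that the map is in general not a contraction and
   existence comes from Brouwer's theorem. For the subproblem the fixed-point
   map is a contraction of constant gamma * kappa < 1/2, and so is the one for
   KKT points when the Lipschitz condition of (c) holds and the radius is small;
   this gives the uniqueness claims. The iterate z^{k+1} of (c) is not assumed
   to be near zbar, but the solution set of the convex subproblem is convex, so
   uniqueness in a ball is uniqueness. The estimate then compares the residuals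
   of z^{k+1} and of zbar^{k+1}. *)

(** * Kuhn's combinatorial lemma *)

Section Kuhn.
Context {I : finType}.
Implicit Types (d e j : I) (x : I -> nat) (f : (I -> nat) -> 'F_2).

Definition step_up d x : I -> nat := fun e => (x e + (e == d))%N.

Definition set_coord d i x : I -> nat := fun e => if e == d then i else x e.

Definition fdiff d f : (I -> nat) -> 'F_2 := fun x => f (step_up d x) - f x.

Lemma step_upC d e x : step_up d (step_up e x) = step_up e (step_up d x).
Proof. by apply: funext => a; rewrite /step_up addnAC. Qed.

Lemma fdiffC d e f x : fdiff d (fdiff e f) x = fdiff e (fdiff d f) x.
Proof. rewrite /fdiff step_upC; ring. Qed.

Lemma addrr_F2 (a : 'F_2) : a + a = 0.
Proof. by apply: (@addrr_pchar2 'F_2); exact: pchar_Fp. Qed.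

(** Each unordered pair {d, e} is counted twice, and 2 = 0 in F_2. This cancellation makes the
    coboundary of a coboundary vanish. *)
Lemma sum_offdiag_F2 (D : {set I}) (G : I -> I -> 'F_2) :
  (forall d e, G d e = G e d) ->
  \sum_(d in D) \sum_(e in D :\ d) G d e = 0.
Proof.
move=> GC.
have E d : \sum_(e in D :\ d) G d e =
    \sum_(e in D | (enum_rank e < enum_rank d)%N) G d e
  + \sum_(e in D | (enum_rank d < enum_rank e)%N) G d e.
  rewrite (bigID (fun e => enum_rank e < enum_rank d)%N) /=.
  congr (_ + _); apply: eq_bigl => e; rewrite !inE.
    case: (e =P d) => [->|_] /=; first by rewrite ltnn andbF.
    by [].
  case: (e =P d) => [->|/eqP ed] /=; first by rewrite ltnn andbF.
  congr (_ && _).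
  by rewrite -leqNgt leq_eqVlt (inj_eq val_inj) (inj_eq enum_rank_inj) eq_sym (negbTE ed).
under eq_bigr do rewrite E.
rewrite big_split /= [X in _ + X](exchange_big_dep (mem D)) //=; last by move=> ? ? _ /andP[].
set A := (X in X + _ = _); rewrite [X in _ + X](_ : _ = A) ?addrr_F2 //.
apply: eq_bigr => d dD; apply: eq_big => [e|e _]; last exact: GC.
by rewrite dD.
Qed.

Variable u : I -> (I -> nat) -> 'F_2.

(* The cup product mod 2 of the coboundaries of the u_j, j in s, summed over the
   monotone lattice paths from x with directions in D. *)
Fixpoint cup (D : {set I}) (s : seq I) x : 'F_2 :=
  if s is j :: s' then
    \sum_(d in D) fdiff d (u j) x * cup (D :\ d) s' (step_up d x)
  else 1.

(* A product of coboundaries is closed, hence du_j cup w = d(u_j w). *)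
Lemma cup_closed_exact s :
  (forall (D : {set I}) x, \sum_(d in D) fdiff d (cup (D :\ d) s) x = 0) /\
  (forall j (D : {set I}) x, cup D (j :: s) x =
     \sum_(d in D) fdiff d (fun y => u j y * cup (D :\ d) s y) x).
Proof.
(* Closedness for [s'] gives exactness for [j :: s'], and exactness gives closedness because
   iterated differences cancel in pairs; the induction alternates between the two. *)
suff exact_of s' : (forall (D : {set I}) x, \sum_(d in D) fdiff d (cup (D :\ d) s') x = 0) ->
    (forall j (D : {set I}) x, cup D (j :: s') x =
     \sum_(d in D) fdiff d (fun y => u j y * cup (D :\ d) s' y) x).
  elim: s => [|i s [cl ex]].
    have cl (D : {set I}) x : \sum_(d in D) fdiff d (cup (D :\ d) [::]) x = 0.
      by rewrite big1 // => d _; rewrite /fdiff /= subrr.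
    by split=> //; exact: exact_of.
  have cl' (D : {set I}) x : \sum_(d in D) fdiff d (cup (D :\ d) (i :: s)) x = 0.
    under eq_bigr => d dD.
      have -> : cup (D :\ d) (i :: s) = fun x => \sum_(e in D :\ d)
          fdiff e (fun y => u i y * cup (D :\ d :\ e) s y) x.
        by apply: funext => y; exact: ex.
      rewrite /fdiff -sumrB; over.
    apply: sum_offdiag_F2 => d e.
    have -> : D :\ e :\ d = D :\ d :\ e by rewrite !finset.setDDl finset.setUC.
    exact: (fdiffC d e (fun y => u i y * cup (D :\ d :\ e) s y) x).
  by split=> //; exact: exact_of.
move=> cl j D x.
(* Discrete Leibniz rule: the second term, zero by closedness, completes the difference of the
   product. *)
transitivity (cup D (j :: s') x + u j x * \sum_(d in D) fdiff d (cup (D :\ d) s') x).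
  by rewrite cl mulr0 addr0.
rewrite /= mulr_sumr -big_split /=.
by apply: eq_bigr => d _; rewrite /fdiff; ring.
Qed.

(** A nonzero sum has a path on which every factor is nonzero, so each label of [s] changes across
    an edge of that path; the bounds keep the edge inside the cube spanned from [x] by [D]. *)
Lemma cup_neq0 s (D : {set I}) x : cup D s x != 0 ->
  forall j, j \in s -> exists y z, [/\ forall d, (x d <= y d <= x d + (d \in D))%N,
    forall d, (x d <= z d <= x d + (d \in D))%N & u j y != u j z].
Proof.
elim: s D x => // i s IH D x /= nz j.
have [d dD] : exists2 d, d \in D & fdiff d (u i) x * cup (D :\ d) s (step_up d x) != 0.
  apply/exists_inP; apply: contraNT nz; rewrite negb_exists_in => /forall_inP H.
  by rewrite big1 // => d dD; apply/eqP; rewrite -[_ == _]negbK; exact: H.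
rewrite mulf_eq0 negb_or => /andP[nz1 nz2].
have stepE e : step_up d x e = (x e + (e == d))%N by [].
rewrite in_cons => /orP[/eqP -> |js].
  exists (step_up d x), x; split=> [e|e|]; last by move: nz1; rewrite subr_eq0.
    rewrite stepE leq_addr leq_add2l /=; case: (e =P d) => [->|//]; by rewrite dD.
  by rewrite leqnn leq_addr.
have [y [z [hy hz yz]]] := IH _ _ nz2 _ js.
have aux e v : (step_up d x e <= v <= step_up d x e + (e \in D :\ d) ->
    x e <= v <= x e + (e \in D))%N.
  rewrite stepE !inE => /andP[h1 h2]; apply/andP; split.
    by apply: leq_trans h1; rewrite leq_addr.
  apply: (leq_trans h2); rewrite -addnA leq_add2l.
  by case: (e =P d) => [->|_] /=; rewrite ?dD.
by exists y, z; split=> // e; apply: aux.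
Qed.

Variable p : nat.

Definition sum_coord d f x : 'F_2 := \sum_(i < p) f (set_coord d i x).

(** The coordinates listed in [s] are overwritten by the summation; the others keep their values in
    [x]. *)
Fixpoint box_sum (s : seq I) f x : 'F_2 :=
  if s is d :: s' then sum_coord d (box_sum s' f) x else f x.

Lemma set_coordC d e i k x : d != e ->
  set_coord d i (set_coord e k x) = set_coord e k (set_coord d i x).
Proof.
move=> de; apply: funext => a; rewrite /set_coord.
case: (a =P d) => [->|//]; by rewrite (negbTE de).
Qed.

Lemma sum_coord_diff d f x :
  sum_coord d (fdiff d f) x = f (set_coord d p x) - f (set_coord d 0 x).
Proof.
rewrite /sum_coord -(big_mkord predT (fun i => fdiff d f (set_coord d i x))).
rewrite -(telescope_sumr (fun i => f (set_coord d i x)) (leq0n p)).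
apply: eq_bigr => i _; rewrite /fdiff; congr (f _ - _).
apply: funext => a; rewrite /step_up /set_coord; case: (a =P d) => _; by rewrite ?addn1 ?addn0.
Qed.

Lemma sum_coordC d e f x :
  sum_coord d (sum_coord e f) x = sum_coord e (sum_coord d f) x.
Proof.
rewrite /sum_coord; have [->//|de] := eqVneq d e.
rewrite exchange_big; apply: eq_bigr => i _; apply: eq_bigr => k _.
by rewrite set_coordC // eq_sym.
Qed.

Lemma box_sum_coordC d s f x :
  box_sum s (sum_coord d f) x = sum_coord d (box_sum s f) x.
Proof.
elim: s x => //= e s IH x; rewrite sum_coordC.
by congr sum_coord; apply: funext => y; exact: IH.
Qed.

(** The sums commute, so the vanishing sum over direction [d] can be taken innermost. *)
Lemma box_sum0 d s f : d \in s -> (forall x, sum_coord d f x = 0) ->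
  forall x, box_sum s f x = 0.
Proof.
move=> + f0; elim: s => //= e s IH; rewrite inE => /orP[/eqP <- x|ds x].
  rewrite -box_sum_coordC; have -> : sum_coord d f = fun=> 0 by exact: funext.
  by elim: s x {IH} => //= a s IH x; apply: big1 => i _; rewrite IH.
by apply: big1 => i _; rewrite IH.
Qed.

Lemma box_sum_sum (J : finType) (P : pred J) s (g : J -> (I -> nat) -> 'F_2) x :
  box_sum s (fun y => \sum_(k | P k) g k y) x = \sum_(k | P k) box_sum s (g k) x.
Proof.
elim: s x => //= d s IH x; rewrite exchange_big; apply: eq_bigr => i _; exact: IH.
Qed.

Lemma box_sum_set_coord d i s f x : d \notin s ->
  box_sum s (fun y => f (set_coord d i y)) x = box_sum s f (set_coord d i x).
Proof.
elim: s x => //= e s IH x; rewrite inE negb_or => /andP[de ds].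
by apply: eq_bigr => k _; rewrite IH // set_coordC.
Qed.

Hypothesis u_low : forall d x, x d = 0%N -> u d x = 0.
Hypothesis u_high : forall d x, x d = p -> u d x = 1.

(** Paths with directions in [D] stay in the face, and [u d] is constant on each of the two faces,
    so the factor of label [d] vanishes. *)
Lemma cup_const d s (D : {set I}) x : d \in s -> d \notin D -> x d = 0%N \/ x d = p ->
  cup D s x = 0.
Proof.
elim: s D x => //= j s IH D x; rewrite inE => /orP[/eqP <- |ds] dD xd.
  apply: big1 => e eD; have ed : (d == e) = false.
    by apply/eqP => E; move: dD; rewrite E eD.
  have {}ed : step_up e x d = x d by rewrite /step_up ed addn0.
  rewrite /fdiff; case: xd => xd; first by rewrite !u_low ?ed // subrr mul0r.
  by rewrite !u_high ?ed // subrr mul0r.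
apply: big1 => e eD; rewrite IH ?mulr0 //; first by rewrite !inE negb_and dD orbT.
by rewrite /step_up (_ : d == e = false) ?addn0 //; apply/eqP => E; move: dD; rewrite E eD.
Qed.

(* Stokes: the sum telescopes to the faces of the box, and only the face
   x d0 = p contributes, since some factor vanishes on each of the others. *)
Lemma box_sum_cup s (D : {set I}) x : uniq s -> D =i s -> box_sum s (cup D s) x = 1.
Proof.
elim: s D x => //= d0 s IH D x /andP[d0s us] Ds.
have -> : box_sum s (fun y => cup D (d0 :: s) y) = box_sum s (fun y =>
    \sum_(d in D) fdiff d (fun z => u d0 z * cup (D :\ d) s z) y).
  by congr box_sum; apply: funext => y; apply: (cup_closed_exact s).2.
have d0D : d0 \in D by rewrite Ds mem_head.
rewrite -[LHS]/(box_sum (d0 :: s) _ x) box_sum_sum (bigD1 d0) //= [X in _ + X]big1 ?addr0.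
  rewrite -box_sum_coordC.
  have -> : sum_coord d0 (fdiff d0 (fun z => u d0 z * cup (D :\ d0) s z)) =
      fun y => cup (D :\ d0) s (set_coord d0 p y).
    apply: funext => y; rewrite sum_coord_diff u_high ?u_low ?mul0r ?mul1r ?subr0 //;
      by rewrite /set_coord eqxx.
  rewrite box_sum_set_coord // IH // => d; rewrite !inE Ds inE.
  by case: (d =P d0) => [->|//]; rewrite (negbTE d0s).
move=> d /andP[dD dd0].
apply: (@box_sum0 d (d0 :: s)); first by rewrite -Ds.
have ds : d \in s by move: dD; rewrite Ds inE (negbTE dd0).
move=> y; rewrite sum_coord_diff !(@cup_const d) ?mulr0 ?subrr //.
- by rewrite !inE eqxx.
- by left; rewrite /set_coord eqxx.
- by rewrite !inE eqxx.
- by right; rewrite /set_coord eqxx.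
Qed.

Lemma box_sum_neq0 s f x : box_sum s f x != 0 ->
  exists2 y, f y != 0 & forall d, d \in s -> (y d < p)%N.
Proof.
(* The list [t] records the coordinates already set to a value below [p]. *)
suff H (t : seq I) : box_sum s f x != 0 -> (forall d, d \in t -> (x d < p)%N) ->
    exists2 y, f y != 0 & forall d, (d \in s) || (d \in t) -> (y d < p)%N.
  by move=> nz; have [//|y h1 h2] := H [::] nz; exists y => // d ds; apply: h2; rewrite ds.
elim: s x t => [|e s IH] x t nz xt; first by exists x.
have [i _ nz'] : exists2 i : 'I_p, true & box_sum s f (set_coord e i x) != 0.
  apply/exists_inP; apply: contraNT nz; rewrite negb_exists_in => /forall_inP H.
  by rewrite /= /sum_coord big1 // => d dD; apply/eqP; rewrite -[_ == _]negbK; exact: H.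
have [|y fy hy] := IH _ (e :: t) nz'.
  move=> d; rewrite inE /set_coord; case: (d =P e) => //= _; exact: xt.
exists y => // d; rewrite inE => /orP[/orP[/eqP->|ds]|dt]; apply: hy;
  by rewrite ?inE ?eqxx ?ds ?dt ?orbT.
Qed.

(** The full product sums to 1 over the box, hence is nonzero on some cell, and there every label
    takes both values. *)
Theorem Kuhn : exists2 x, (forall d, x d < p)%N &
  forall j, exists y z, [/\ forall d, (x d <= y d <= (x d).+1)%N,
    forall d, (x d <= z d <= (x d).+1)%N & u j y != u j z].
Proof.
have D1 : [set: I]%SET =i enum I by move=> d; rewrite inE mem_enum.
have := @box_sum_cup (enum I) [set: I]%SET (fun=> 0%N) (enum_uniq _) D1.
move=> /(congr1 (fun a => a != 0)); rewrite oner_neq0 => /box_sum_neq0[x nz xp].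
exists x => [d|j]; first by apply: xp; rewrite mem_enum.
have [|y [z [hy hz yz]]] := cup_neq0 _ _ _ nz j; first by rewrite mem_enum.
by exists y, z; split=> // d; have := hy d; have := hz d; rewrite inE addn1.
Qed.

End Kuhn.

(** * Brouwer's fixed-point theorem on a cube *)

Section Brouwer.
Context {R : realType}.

Lemma mx_norm_coord {m n} (A : 'M[R]_(m, n)) i j : `|A i j| <= `|A|.
Proof.
rewrite [leRHS]/Num.norm /= mx_normrE.
by apply/bigmax_geP; right; exists (i, j).
Qed.

Lemma mx_norm_le {m n} (A : 'M[R]_(m, n)) (e : R) :
  0 <= e -> (forall i j, `|A i j| <= e) -> `|A| <= e.
Proof.
move=> e0 h; rewrite [leLHS]/Num.norm /= mx_normrE.
by apply/bigmax_leP; split => // -[i j] _; exact: h.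
Qed.

Lemma coord_continuous_at {m n} (V : topologicalType) (f : V -> 'M[R]_(m, n)) x i j :
  {for x, continuous f} -> {for x, continuous (fun y => f y i j)}.
Proof.
move=> fx; apply: (@continuous_comp _ _ _ f (fun A : 'M[R]_(m, n) => A i j)) => //.
exact: coord_continuous.
Qed.

(** Bolzano-Weierstrass in terms of a cluster point, transposed from the compactness of boxes of row
    vectors. *)
Lemma cV_cluster {N : nat} (s : R) (a : nat -> 'cV[R]_N) :
  (forall q, `|a q| <= s) ->
  exists x : 'cV[R]_N, forall e, 0 < e -> forall Q, exists2 q, (Q <= q)%N & `|x - a q| < e.
Proof.
move=> ha.
have : compact [set v : 'rV[R]_N | forall i, `[- s, s]%classic (v ord0 i)].
  by apply: (@rV_compact R N (fun=> `[- s, s]%classic)) => _; exact: segment_compact.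
move=> /(_ ((fun q => (a q)^T) @ \oo) _) [].
  exists 0%N => // q _ i /=; rewrite in_itv /= -ler_norml mxE.
  exact: le_trans (mx_norm_coord _ _ _) (ha q).
move=> v [_ clv]; exists v^T => e e0 Q.
have [|w [[q /= Qq <-]]] := clv [set (a q)^T | q in [set q | (Q <= q)%N]]
  (ball v e) _ (nbhsx_ballx _ _ e0).
  by exists Q => // q /= Qq; exists q.
rewrite -ball_normE /= => bq; exists q => //.
apply: le_lt_trans bq; apply: mx_norm_le => // i j.
have -> : (v^T - a q) i j = (v - (a q)^T) j i by rewrite !mxE.
exact: mx_norm_coord.
Qed.

(** Kuhn's lemma on ever finer grids gives small cells on which each component of f - id takes both
    weak signs; a cluster point of these cells is fixed. *)
Theorem Brouwer_cube {N : nat} (f : 'cV[R]_N -> 'cV[R]_N) (s : R) :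
  0 < s -> continuous f -> (forall x, `|f x| <= s) -> exists x, f x = x.
Proof.
move=> s0 fc fs.
(* The indices 0, ..., q+1 are mapped onto a grid of [-s, s] of mesh 2s/(q+1). *)
pose pt q (k : 'I_N -> nat) : 'cV[R]_N := \col_d (- s + 2 * s * (k d)%:R / q.+1%:R).
(* A true label says that [f] does not increase coordinate [d]. The clauses at 0 and [q.+1] impose
   the boundary values of Kuhn's lemma; they are consistent with the signs because [f] takes values
   in the cube. *)
pose lab q d k : bool := (q.+1 <= k d)%N || ((0 < k d)%N && (f (pt q k) d 0 < pt q k d 0)).
have labP q d k : lab q d k -> f (pt q k) d 0 <= pt q k d 0.
  case/orP => [kq|/andP[_ /ltW //]].
  have := mx_norm_coord (f (pt q k)) d 0 => /le_trans/(_ (fs _)).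
  rewrite ler_norml => /andP[_ h]; apply: (le_trans h); rewrite mxE.
  have : 1 <= (k d)%:R / q.+1%:R :> R by rewrite ler_pdivlMr ?ltr0n // mul1r ler_nat.
  rewrite -mulrA; set t := _ / _ => t1; nra.
have labN q d k : ~~ lab q d k -> pt q k d 0 <= f (pt q k) d 0.
  rewrite negb_or negb_and -leNgt => /andP[_ /orP[|//]]; rewrite -eqn0Ngt => /eqP kd.
  have := mx_norm_coord (f (pt q k)) d 0 => /le_trans/(_ (fs _)).
  by rewrite ler_norml => /andP[h _]; rewrite [leLHS]mxE kd mulr0 mul0r addr0.
have cell q : exists x, `|x| <= s /\ forall d, exists y z,
    [/\ `|x - y| <= 2 * s / q.+1%:R, `|x - z| <= 2 * s / q.+1%:R,
        f y d 0 <= y d 0 & z d 0 <= f z d 0].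
  have [d k kd|d k kd|k kq H] := @Kuhn 'I_N (fun d k => (lab q d k)%:R) q.+1.
  - by rewrite /lab kd.
  - by rewrite /lab kd leqnn.
  have c0 : 0 <= 2 * s / q.+1%:R by rewrite divr_ge0 // mulr_ge0 // ltW.
  have near k' : (forall d, k d <= k' d <= (k d).+1)%N ->
      `|pt q k - pt q k'| <= 2 * s / q.+1%:R.
    move=> hk; apply: mx_norm_le => // i j.
    rewrite !mxE; have /andP[h1 h2] := hk i.
    have {}h1 : (k i)%:R <= (k' i)%:R :> R by rewrite ler_nat.
    have {}h2 : (k' i)%:R <= (k i)%:R + 1 :> R by rewrite natr1 ler_nat.
    have -> : - s + 2 * s * (k i)%:R / q.+1%:R - (- s + 2 * s * (k' i)%:R / q.+1%:R) =
      - (2 * s / q.+1%:R * ((k' i)%:R - (k i)%:R)) by ring.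
    by rewrite normrN ger0_norm; [rewrite ler_piMr //; lra|rewrite mulr_ge0 //; lra].
  exists (pt q k); split.
    apply: mx_norm_le => [|i j]; first exact: ltW.
    rewrite !mxE ler_norml.
    have h1 : 0 <= (k i)%:R / q.+1%:R :> R by rewrite divr_ge0.
    have h2 : (k i)%:R / q.+1%:R <= 1 :> R.
      by rewrite ler_pdivrMr ?ltr0n // mul1r ler_nat ltnW.
    by rewrite -mulrA; move: h1 h2; set t := _ / _ => h1 h2; apply/andP; split; nra.
  move=> d; have [y [z [hy hz yz]]] := H d.
  case ly: (lab q d y) (yz); case lz: (lab q d z); rewrite ?eqxx // => _.
    exists (pt q y), (pt q z); split; rewrite ?near //; first exact: labP.
    by apply: labN; rewrite lz.
  exists (pt q z), (pt q y); split; rewrite ?near //; first exact: labP.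
  by apply: labN; rewrite ly.
have [a ha] := choice cell.
have [x xcl] := @cV_cluster N s a (fun q => (ha q).1).
apply: contrapT => nfx.
have [d fd] : exists d, f x d 0 <> x d 0.
  apply: contrapT => H; apply: nfx; exists x; apply/colP => d; apply: contrapT => fd.
  by apply: H; exists d.
pose h (y : 'cV[R]_N) := f y d 0 - y d 0.
have hc : {for x, continuous h}.
  apply: continuousB; first exact: (@coord_continuous_at _ _ _ f x d 0 (fc x)).
  exact: coord_continuous.
have e1 : 0 < `|h x| by rewrite normr_gt0 subr_eq0; apply/eqP.
move/cvgrPdist_lt: hc => /(_ _ e1) /nbhs_ballP[e /= e0 He].
(* By continuity the [d]-th displacement keeps its strict sign on a ball around [x], which a small
   cell with both weak signs contradicts. *)
have Hfalse : (forall y, `|x - y| < e -> f y d 0 < y d 0) \/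
    (forall y, `|x - y| < e -> y d 0 < f y d 0).
  have [neg|pos] : h x < 0 \/ 0 < h x by apply/orP; rewrite -neq_lt -normr_gt0.
    left=> y xy; have := He y; rewrite -ball_normE /= => /(_ xy).
    rewrite (ltr0_norm neg) ltr_norml => /andP[+ _]; rewrite /h => ?; lra.
  right=> y xy; have := He y; rewrite -ball_normE /= => /(_ xy).
  rewrite (gtr0_norm pos) ltr_norml => /andP[_ +]; rewrite /h => ?; lra.
(* From this index on the mesh is below e/2; the other e/2 is the distance to the cluster point. *)
have [Q Qs] : exists Q : nat, 4 * s / e < Q.+1%:R.
  exists (Num.truncn (4 * s / e)); have := Num.Theory.truncnS_gt (4 * s / e); by [].
have [q Qq hq] := xcl (e / 2) (divr_gt0 e0 (ltr0n _ 2)) Q.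
have [y [z [hy hz fy fz]]] := (ha q).2 d.
have small : 2 * s / q.+1%:R < e / 2.
  rewrite ltr_pdivrMr ?ltr0n //.
  have : Q.+1%:R <= q.+1%:R :> R by rewrite ler_nat ltnS.
  move=> /(lt_le_trans Qs); rewrite ltr_pdivrMr // => ?; lra.
have xy w : `|a q - w| <= 2 * s / q.+1%:R -> `|x - w| < e.
  move=> /le_lt_trans/(_ small) hw; rewrite (splitr e).
  by apply: le_lt_trans (ler_distD (a q) x w) _; rewrite ltrD.
case: Hfalse => [/(_ z (xy _ hz))|/(_ y (xy _ hy))]; by rewrite ltNge ?fz ?fy.
Qed.

End Brouwer.

(** * Euclidean norm *)

Section EuclideanNorm.
Context {R : realType}.
Implicit Types (n m : nat).

Lemma dotpC {n} (u v : 'cV[R]_n) : dotp u v = dotp v u.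
Proof. by apply: eq_bigr => i _; rewrite mulrC. Qed.

Lemma dotpDr {n} (u v w : 'cV[R]_n) : dotp u (v + w) = dotp u v + dotp u w.
Proof. by rewrite -big_split; apply: eq_bigr => i _; rewrite mxE mulrDr. Qed.

Lemma dotpZr {n} a (u v : 'cV[R]_n) : dotp u (a *: v) = a * dotp u v.
Proof. by rewrite mulr_sumr; apply: eq_bigr => i _; rewrite mxE mulrCA. Qed.

Lemma dotpNr {n} (u v : 'cV[R]_n) : dotp u (- v) = - dotp u v.
Proof. by rewrite -scaleN1r dotpZr mulN1r. Qed.

Lemma dotpBr {n} (u v w : 'cV[R]_n) : dotp u (v - w) = dotp u v - dotp u w.
Proof. by rewrite dotpDr dotpNr. Qed.

Lemma dotpDl {n} (u v w : 'cV[R]_n) : dotp (u + v) w = dotp u w + dotp v w.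
Proof. by rewrite dotpC dotpDr !(dotpC w). Qed.

Lemma dotpZl {n} a (u v : 'cV[R]_n) : dotp (a *: u) v = a * dotp u v.
Proof. by rewrite dotpC dotpZr dotpC. Qed.

Lemma dotpNl {n} (u v : 'cV[R]_n) : dotp (- u) v = - dotp u v.
Proof. by rewrite dotpC dotpNr dotpC. Qed.

Lemma dotpBl {n} (u v w : 'cV[R]_n) : dotp (u - v) w = dotp u w - dotp v w.
Proof. by rewrite dotpDl dotpNl. Qed.

Lemma dotp_ge0 {n} (u : 'cV[R]_n) : 0 <= dotp u u.
Proof. by apply: sumr_ge0 => i _; rewrite -expr2 sqr_ge0. Qed.

Lemma dotp_eq0 {n} (u : 'cV[R]_n) : dotp u u = 0 -> u = 0.
Proof.
move=> /eqP; rewrite psumr_eq0 => [/allP u0|i _]; last by rewrite -expr2 sqr_ge0.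
apply/colP => i; have /implyP/(_ isT) := u0 i (mem_index_enum i).
by rewrite mulf_eq0 orbb mxE => /eqP.
Qed.

Lemma enorm_ge0 {n} (u : 'cV[R]_n) : 0 <= enorm u.
Proof. exact: sqrtr_ge0. Qed.

Lemma enorm_sqr {n} (u : 'cV[R]_n) : enorm u ^+ 2 = dotp u u.
Proof. by rewrite sqr_sqrtr // dotp_ge0. Qed.

Lemma enorm0 {n} : enorm (0 : 'cV[R]_n) = 0.
Proof. by rewrite /enorm /dotp big1 ?sqrtr0 // => i _; rewrite mxE mul0r. Qed.

Lemma enorm_eq0 {n} (u : 'cV[R]_n) : enorm u = 0 -> u = 0.
Proof. by move=> u0; apply: dotp_eq0; rewrite -enorm_sqr u0 expr0n. Qed.

Lemma enormZ {n} a (u : 'cV[R]_n) : enorm (a *: u) = `|a| * enorm u.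
Proof. by rewrite /enorm dotpZl dotpZr mulrA -expr2 sqrtrM ?sqr_ge0 // sqrtr_sqr. Qed.

Lemma enormN {n} (u : 'cV[R]_n) : enorm (- u) = enorm u.
Proof. by rewrite -scaleN1r enormZ normrN normr1 mul1r. Qed.

Lemma edistC {n} (u v : 'cV[R]_n) : enorm (u - v) = enorm (v - u).
Proof. by rewrite -enormN opprB. Qed.

(** Cauchy-Schwarz, from expanding the square of (v.v) u - (u.v) v. *)
Lemma dotp_le {n} (u v : 'cV[R]_n) : dotp u v <= enorm u * enorm v.
Proof.
have [v0|vn0] := eqVneq (enorm v) 0.
  by rewrite v0 mulr0 (enorm_eq0 _ v0) -(scale0r 0) dotpZr mul0r.
have v2 : 0 < dotp v v by rewrite -enorm_sqr exprn_gt0 // lt0r vn0 enorm_ge0.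
apply: le_trans (ler_norm _) _.
rewrite -ler_sqr ?nnegrE ?mulr_ge0 ?enorm_ge0 // real_normK ?num_real //.
rewrite exprMn !enorm_sqr.
have := dotp_ge0 (dotp v v *: u - dotp u v *: v).
rewrite dotpBl !dotpBr !dotpZl !dotpZr (dotpC v u).
have -> : dotp v v * (dotp v v * dotp u u) - dotp v v * (dotp u v * dotp u v) -
    (dotp u v * (dotp v v * dotp u v) - dotp u v * (dotp u v * dotp v v)) =
    dotp v v * (dotp u u * dotp v v - dotp u v ^+ 2) by ring.
by rewrite pmulr_rge0 // subr_ge0.
Qed.

Lemma enormD {n} (u v : 'cV[R]_n) : enorm (u + v) <= enorm u + enorm v.
Proof.
rewrite -ler_sqr ?nnegrE ?addr_ge0 ?enorm_ge0 // sqrrD !enorm_sqr.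
rewrite dotpDl !dotpDr (dotpC v u).
have := dotp_le u v; lra.
Qed.

Lemma edistD {n} (w u v : 'cV[R]_n) : enorm (u - v) <= enorm (u - w) + enorm (w - v).
Proof. by rewrite -[u - v](subrKA w) enormD. Qed.

Lemma enorm_dist {n} (u v : 'cV[R]_n) : `|enorm u - enorm v| <= enorm (u - v).
Proof.
rewrite ler_norml; apply/andP; split.
  have := enormD (v - u) u; rewrite subrK edistC; lra.
have := enormD (u - v) v; rewrite subrK; lra.
Qed.

Lemma mx_norm_le_enorm {n} (u : 'cV[R]_n) : `|u| <= enorm u.
Proof.
apply: mx_norm_le => [|i j]; first exact: enorm_ge0.
rewrite -ler_sqr ?nnegrE ?enorm_ge0 // real_normK ?num_real // enorm_sqr.
rewrite /dotp (bigD1 i) //= ord1 -expr2 lerDl.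
by apply: sumr_ge0 => k _; rewrite -expr2 sqr_ge0.
Qed.

(** A crude constant suffices; n+1 is positive even in dimension 0, so it can be divided by. *)
Lemma enorm_le_mx_norm {n} (u : 'cV[R]_n) : enorm u <= n.+1%:R * `|u|.
Proof.
rewrite -ler_sqr ?nnegrE ?mulr_ge0 ?enorm_ge0 // enorm_sqr.
apply: (@le_trans _ _ (\sum_(i < n) `|u| ^+ 2)).
  apply: ler_sum => i _.
  by rewrite -expr2 -real_normK ?num_real // ler_sqr ?nnegrE // mx_norm_coord.
rewrite sumr_const card_ord -[leLHS]mulr_natl exprMn ler_wpM2r ?sqr_ge0 //.
by rewrite -natrX ler_nat expnS expn1 mulSn -[leqLHS]addn0 leq_add // ltnW.
Qed.

Lemma enorm_mulmx_bounded {m n} (A : 'M[R]_(m, n)) :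
  exists2 B, 0 <= B & forall v, enorm (A *m v) <= B * enorm v.
Proof.
exists (m.+1%:R * (n%:R * `|A|)) => [|v]; first by rewrite !mulr_ge0.
apply: le_trans (enorm_le_mx_norm _) _; rewrite -mulrA ler_wpM2l //.
apply: (@le_trans _ _ (n%:R * `|A| * `|v|)); last first.
  by rewrite ler_wpM2l ?mulr_ge0 ?mx_norm_le_enorm.
apply: mx_norm_le => [|i j]; first by rewrite !mulr_ge0.
rewrite mxE; apply: le_trans (ler_norm_sum _ _ _) _.
apply: (@le_trans _ _ (\sum_(k < n) `|A| * `|v|)).
  by apply: ler_sum => k _; rewrite normrM ler_pM ?mx_norm_coord.
by rewrite sumr_const card_ord -[leLHS]mulr_natl mulrA.
Qed.

(** The vector v/|v| competes in the supremum, which is an upper bound because the set is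
    bounded. *)
Lemma opnormP {m n} (A : 'M[R]_(m, n)) v : enorm (A *m v) <= opnorm A * enorm v.
Proof.
have [B B0 HB] := enorm_mulmx_bounded A.
have [v0|vn0] := eqVneq (enorm v) 0.
  by rewrite (enorm_eq0 _ v0) mulmx0 !enorm0 mulr0.
have v_gt0 : 0 < enorm v by rewrite lt0r vn0 enorm_ge0.
rewrite -ler_pdivrMr //; apply: ub_le_sup.
  exists B => _ [w /= w1 <-]; apply: le_trans (HB w) _.
  by rewrite ler_piMr.
exists ((enorm v)^-1 *: v).
  by rewrite /= enormZ ger0_norm ?invr_ge0 ?enorm_ge0 // mulVf.
by rewrite -scalemxAr enormZ ger0_norm ?invr_ge0 ?enorm_ge0 // mulrC.
Qed.

Lemma opnorm_ge0 {m n} (A : 'M[R]_(m, n)) : 0 <= opnorm A.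
Proof.
have [B B0 HB] := enorm_mulmx_bounded A.
apply: ub_le_sup; last by exists 0; rewrite /= ?mulmx0 enorm0.
exists B => _ [w /= w1 <-]; apply: le_trans (HB w) _.
by rewrite ler_piMr.
Qed.

Lemma enorm_continuous {n} : continuous (@enorm R n).
Proof.
move=> x; apply/(@cvgrPdist_lt _ _ _ (nbhs x) _) => e e0.
apply/nbhs_ballP; exists (e / n.+1%:R); first by rewrite /= divr_gt0.
move=> y; rewrite -ball_normE /= => xy; apply: le_lt_trans (enorm_dist _ _) _.
apply: le_lt_trans (enorm_le_mx_norm _) _.
by rewrite mulrC -ltr_pdivlMr.
Qed.

(** The bound is relative to [h] so that a map Lipschitz on part of the space only can be treated
    after composition with a retraction. *)
Lemma enorm_lipschitz_continuous {T : topologicalType} {m n}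
    (f : T -> 'cV[R]_m) (h : T -> 'cV[R]_n) (L : R) :
  (forall x y, enorm (f x - f y) <= L * enorm (h x - h y)) ->
  continuous h -> continuous f.
Proof.
move=> fL hc x; apply/cvgrPdist_lt => e e0.
pose K := (`|L| + 1) * n.+1%:R.
have K0 : 0 < K by rewrite mulr_gt0 // ltr_wpDl.
have e1 : 0 < e / K by rewrite divr_gt0.
have := hc x; move/cvgrPdist_lt => /(_ _ e1).
apply: filterS => y xy; apply: le_lt_trans (mx_norm_le_enorm _) _.
apply: le_lt_trans (fL _ _) _.
apply: (@le_lt_trans _ _ (K * `|h x - h y|)); last by rewrite mulrC -ltr_pdivlMr.
have := enorm_le_mx_norm (h x - h y); have := enorm_ge0 (h x - h y).
have := ler_norm L; have := normr_ge0 L; rewrite /K -mulrA; nra.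
Qed.

End EuclideanNorm.

(** * Brouwer's theorem on a Euclidean ball; Jacobians *)

Section BrouwerBall.
Context {R : realType} {n : nat}.

(** Radial projection onto the closed ball; the maximum covers inside and outside at once and keeps
    the denominator positive for positive [r]. *)
Definition ball_retract (a : 'cV[R]_n) (r : R) (x : 'cV[R]_n) : 'cV[R]_n :=
  a + (r / Num.max r (enorm (x - a))) *: (x - a).

Lemma ball_retract_continuous a r : 0 < r -> continuous (ball_retract a r).
Proof.
move=> r0 x.
have sc : (y - a) @[y --> x] --> x - a.
  by apply: (@cvgB _ _ _ (nbhs x) _); [exact: cvg_id|exact: (@cvg_cst _ a _ (nbhs x) _)].
apply: (@cvgD _ _ _ (nbhs x) _); first exact: (@cvg_cst _ a _ (nbhs x) _).
apply: (@cvgZ _ _ _ (nbhs x) _) => //; apply: (@cvgM _ _ (nbhs x) _).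
  exact: (@cvg_cst _ r _ (nbhs x) _).
apply: (@cvgV _ _ (nbhs x) _); first by rewrite gt_eqF // lt_max r0.
have mx : {for x, continuous ((cst r : 'cV[R]_n -> R^o) \max (fun y => enorm (y - a)))}.
  apply: continuous_max; first exact: cst_continuous.
  exact: (cvg_comp _ _ sc (@enorm_continuous R n _)).
exact: mx.
Qed.

Lemma ball_retract_le a r x : 0 < r -> enorm (ball_retract a r x - a) <= r.
Proof.
move=> r0; rewrite /ball_retract addrC addKr enormZ.
have m0 : 0 < Num.max r (enorm (x - a)) by rewrite lt_max r0.
rewrite ger0_norm ?divr_ge0 ?(ltW r0) ?(ltW m0) // mulrAC ler_pdivrMr //.
by rewrite ler_pM2l // le_max lexx orbT.
Qed.

Lemma ball_retract_id a r x : 0 < r -> enorm (x - a) <= r -> ball_retract a r x = x.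
Proof.
move=> r0 xr; rewrite /ball_retract max_l // divff ?gt_eqF // scale1r.
by rewrite addrC subrK.
Qed.

(** Composed with the retraction, [f] maps a large cube into the ball. A fixed point of the
    composite lies in the ball, where the retraction is the identity. *)
Theorem Brouwer_ball (f : 'cV[R]_n -> 'cV[R]_n) a r : 0 < r ->
  continuous (f \o ball_retract a r) ->
  (forall x, enorm (x - a) <= r -> enorm (f x - a) <= r) ->
  exists2 x, enorm (x - a) <= r & f x = x.
Proof.
move=> r0 fc fr.
have fr' x : enorm (f (ball_retract a r x) - a) <= r by apply/fr/ball_retract_le.
have [|x|x fx] := @Brouwer_cube R n (f \o ball_retract a r) (`|a| + r) _ fc.
- by rewrite ltr_wpDl.
- rewrite /= -[f _](subrK a) addrC; apply: le_trans (ler_normD _ _) _.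
  by rewrite lerD2l; apply: le_trans (mx_norm_le_enorm _) _.
have xr : enorm (x - a) <= r by rewrite -fx; exact: fr'.
by exists x => //; move: fx; rewrite /= ball_retract_id.
Qed.

End BrouwerBall.

Section Jacobian.
Context {R : realType}.

Lemma jacE {m n} (f : 'cV[R]_n -> 'cV[R]_m) x v : 'd f x v = jac f x *m v.
Proof.
apply/colP => i; rewrite mxE [v in LHS]matrix_sum_delta.
under eq_bigr do rewrite big_ord1.
rewrite linear_sum summxE; apply: eq_bigr => j _.
by rewrite linearZ !mxE mulrC ord1.
Qed.

Lemma differentiable_coords {V : normedModType R} {m n} (f : V -> 'M[R]_(m, n)) x :
  (forall i j, differentiable (fun y => f y i j) x) -> differentiable f x.
Proof.
move=> fd.
have -> : f = \sum_(i < m) (\sum_(j < n) (fun y => f y i j *: delta_mx i j)).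
  apply: funext => y; rewrite fct_sumE [LHS]matrix_sum_delta.
  by apply: eq_bigr => i _; rewrite fct_sumE.
apply: differentiable_sum => i; apply: differentiable_sum => j.
exact: differentiableZl.
Qed.

Lemma jac_littleo {m n} (f : 'cV[R]_n -> 'cV[R]_m) x : differentiable f x ->
  forall e, 0 < e -> exists2 r, 0 < r & forall y, enorm (y - x) < r ->
    enorm (f y - f x - jac f x *m (y - x)) <= e * enorm (y - x).
Proof.
move=> fd e e0.
(* The factor m+1 pays for passing from the maximum norm to the Euclidean norm. *)
have e1 : 0 < e / m.+1%:R by rewrite divr_gt0.
have /eqaddoP/(_ _ e1) := diff_locally fd.
move=> /nbhs_ballP[r /= r0 Hr]; exists r => // y yr.
have {Hr} := Hr (y - x); rewrite -ball_normE /= sub0r normrN.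
move=> /(_ (le_lt_trans (mx_norm_le_enorm _) yr)).
rewrite !fctE /= /cst subrK jacE opprD addrA => H.
apply: le_trans (enorm_le_mx_norm _) _.
rewrite mulrC -ler_pdivlMr // mulrAC; apply: (le_trans H).
by rewrite ler_pM2l // mx_norm_le_enorm.
Qed.

(* The scalar mean value theorem along the segment, applied to the pairing
   with the error vector itself. *)
Lemma jac_mean_value {m n} (f : 'cV[R]_n -> 'cV[R]_m) (A : 'M[R]_(m, n)) x y B :
  (forall z, differentiable f z) ->
  (forall t, 0 <= t <= 1 -> opnorm (jac f (x + t *: (y - x)) - A) <= B) ->
  enorm (f y - f x - A *m (y - x)) <= B * enorm (y - x).
Proof.
move=> fd HB; set v := y - x; set e := f y - f x - A *m v.
(* If the error vanishes, only B >= 0 remains, which follows from the bound at t = 0. *)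
have [e0|en0] := eqVneq (enorm e) 0.
  have := HB 0; rewrite lexx ler01 => /(_ isT) /(le_trans (opnorm_ge0 _)) B0.
  by rewrite e0 mulr_ge0 ?enorm_ge0.
have e_gt0 : 0 < enorm e by rewrite lt0r en0 enorm_ge0.
have ed w : differentiable (dotp e : 'cV[R]_m -> R^o) w.
  have -> : (dotp e : 'cV[R]_m -> R^o) =
      \sum_(i < m) ((fun w : 'cV[R]_m => e i 0 *: (w i 0 : R^o))).
    by apply: funext => u; rewrite fct_sumE.
  apply: differentiable_sum => i; apply: differentiableZ; exact: differentiable_coord.
have elin : linear (dotp e : 'cV[R]_m -> R^o) by move=> a u w; rewrite dotpDr dotpZr.
pose L : {linear 'cV[R]_m -> R^o} := HB.pack (dotp e : 'cV[R]_m -> R^o)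
  (GRing.isLinear.Build _ _ _ _ (dotp e : 'cV[R]_m -> R^o) elin).
have dL w : 'd (dotp e : 'cV[R]_m -> R^o) w = dotp e :> (_ -> _).
  by apply: (diff_lin w (f := L)) => u; exact: differentiable_continuous.
(* The increment of [h] from 0 to 1 is |e|^2, while its derivative pairs [e] with (jac f - A) v. *)
pose h t : R^o := dotp e (f (x + t *: v)) - t * dotp e (A *m v).
have hd (t : R) : is_derive t (1 : R) h (dotp e (jac f (x + t *: v) *m v) - dotp e (A *m v)).
  have gd : is_diff t (fun s : R^o => x + s *: v) (fun s => s *: v).
    have -> : (fun s : R => s *: v) = 0 + (fun s : R => s *: v) by rewrite add0r.
    apply: is_diffD.
  have fgd : is_diff t (fun s : R^o => dotp e (f (x + s *: v)) : R^o)
      (fun s => dotp e (jac f (x + t *: v) *m (s *: v))).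
    have fd' : is_diff (x + t *: v) f ('d f (x + t *: v)) by apply: DiffDef.
    have Ld : is_diff (f (x + t *: v)) (dotp e : 'cV[R]_m -> R^o) (dotp e) by apply: DiffDef.
    have := is_diff_comp (is_diff_comp gd fd') Ld.
    by congr (is_diff _ _ _); apply: funext => s; rewrite /= jacE.
  have qd : is_diff t (fun s : R^o => s *: (dotp e (A *m v) : R^o))
      (fun s => s *: (dotp e (A *m v) : R^o)) by apply: is_diff_scalel.
  have pqd := is_diffB fgd qd.
  apply: DeriveDef; first exact: diff_derivable.
  by rewrite deriveE // diff_val !fctE !scale1r.
have [|c c01] := MVT ltr01 (fun t _ => hd t).
  apply: derivable_within_continuous => t _; exact: ex_derive.
rewrite /h scale1r scale0r addr0 mul1r mul0r subr0 subr0 mulr1 [x + v]addrC subrK.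
rewrite -dotpBr -mulmxBl.
have -> : dotp e (f y) - dotp e (A *m v) - dotp e (f x) = dotp e e.
  by rewrite -!dotpBr addrAC.
rewrite -enorm_sqr => hc.
have c01' : 0 <= c <= 1 by move: c01; rewrite in_itv /= => /andP[c0 c1]; rewrite !ltW.
have opc := opnormP (jac f (x + c *: v) - A) v; have HBc := HB c c01'.
rewrite -(ler_pM2l e_gt0) -expr2 hc.
apply: le_trans (dotp_le _ _) _; rewrite ler_wpM2l ?enorm_ge0 //.
by apply: le_trans opc _; rewrite ler_wpM2r ?enorm_ge0.
Qed.

End Jacobian.

(** * Differentiability of the KKT map *)

Section KKTMap.
Context {R : realType} {n m : nat}.
Variables (c : 'cV[R]_n) (g : 'cV[R]_n -> 'cV[R]_m).
Hypothesis g_diff2 : twice_differentiable g.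

(** The first block contains products of entries of [jac g] with multipliers, so the second
    differentiability of [g] enters here. *)
Lemma kktF_differentiable z : differentiable (kktF c g) z.
Proof.
have ud : differentiable (usubmx : 'cV[R]_(n + m) -> 'cV[R]_n) z.
  apply: differentiable_coords => i j.
  have -> : (fun y : 'cV[R]_(n + m) => usubmx y i j) = fun y => y (lshift m i) j.
    by apply: funext => y; rewrite mxE.
  exact: differentiable_coord.
apply: differentiable_coords => i j; rewrite ord1.
case: (split_ordP i) => k ->.
  have -> : (fun y => kktF c g y (lshift m k) 0) =
      cst (c k 0) + \sum_(l < m) (fun y => (jac g (usubmx y) l k : R) * y (rshift n l) 0).
    apply: funext => y; rewrite /kktF col_mxEu fctE fct_sumE !mxE.
    by congr (_ + _); apply: eq_bigr => l _; rewrite !mxE.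
  apply: differentiableD => //; apply: differentiable_sum => l.
  apply: differentiableM; last exact: differentiable_coord.
  apply: (differentiable_comp (g := fun A : 'M[R]_(m, n) => A l k));
    last exact: differentiable_coord.
  exact: (differentiable_comp ud (g_diff2.2 _)).
have -> : (fun y => kktF c g y (rshift n k) 0) = fun y => g (usubmx y) k 0.
  by apply: funext => y; rewrite /kktF col_mxEd.
apply: (differentiable_comp (g := fun A : 'cV[R]_m => A k 0)); last exact: differentiable_coord.
exact: (differentiable_comp ud (g_diff2.1 _)).
Qed.

Lemma kktF_continuous : continuous (kktF c g).
Proof. by move=> z; exact/differentiable_continuous/kktF_differentiable. Qed.

End KKTMap.

(** * Generalized equations *)

Section GeneralizedEquation.
Context {R : realType} {N : nat}.
Variable K : set 'cV[R]_N.

(** The common form of the KKT system, of the subproblem and, after a shift by [d], of the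
    linearized system. *)
Definition gen_eq_sol (G : 'cV[R]_N -> 'cV[R]_N) : set 'cV[R]_N :=
  [set z | exists2 u, normal_cone K z u & 0 = G z + u].

Lemma gen_eq_solP G z :
  gen_eq_sol G z <-> K z /\ forall v, K v -> 0 <= dotp (G z) (v - z).
Proof.
split=> [[u [Kz Hu] /esym/eqP]|[Kz H]].
  rewrite addr_eq0 => /eqP ->; split=> // v Kv.
  by rewrite dotpNl -dotpNr opprB; exact: Hu.
exists (- G z); last by rewrite subrr.
by split=> // v Kv; rewrite dotpNl -dotpNr opprB; exact: H.
Qed.

(* Both inequalities between two solutions z1 and z2 are equalities by
   monotonicity, so the variational inequalities can be averaged. *)
Lemma monotone_gen_eq_sol_convex (q : 'cV[R]_N) (P : 'M[R]_N) z1 z2 t :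
  (forall x y s, K x -> K y -> 0 <= s <= 1 -> K (x + s *: (y - x))) ->
  (forall v, 0 <= dotp v (P *m v)) -> 0 <= t <= 1 ->
  gen_eq_sol (fun z => q + P *m z) z1 -> gen_eq_sol (fun z => q + P *m z) z2 ->
  gen_eq_sol (fun z => q + P *m z) (z1 + t *: (z2 - z1)).
Proof.
move=> Kc Pm t01 /gen_eq_solP[K1 H1] /gen_eq_solP[K2 H2]; apply/gen_eq_solP.
split=> [|v Kv]; first exact: Kc.
have a1 := H1 _ K2; have a2 := H2 _ K1; have b1 := H1 _ Kv; have b2 := H2 _ Kv.
have := Pm (z2 - z1); move: t01 => /andP[t0 t1].
set T1 := q + P *m z1 in a1 b1; set T2 := q + P *m z2 in a2 b2.
have -> : P *m (z2 - z1) = T2 - T1 by rewrite mulmxBr opprD addrACA subrr add0r.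
have -> : q + P *m (z1 + t *: (z2 - z1)) = (1 - t) *: T1 + t *: T2.
  by rewrite mulmxDr -scalemxAr mulmxBr; apply/colP => i; rewrite !mxE; ring.
have -> : v - (z1 + t *: (z2 - z1)) = (1 - t) *: (v - z1) + t *: (v - z2).
  by apply/colP => i; rewrite !mxE; ring.
clearbody T1 T2; move: a1 a2 b1 b2.
rewrite !(dotpDl, dotpDr, dotpZl, dotpZr, dotpNr, dotpNl).
rewrite !(dotpC z2) !(dotpC z1) => a1 a2 b1 b2 m.
have e1 : dotp T1 z1 = dotp T1 z2 by lra.
have e2 : dotp T2 z1 = dotp T2 z2 by lra.
move: b1 b2; rewrite e1 e2.
set x1 := dotp T1 v; set x2 := dotp T2 v; set y1 := dotp T1 z2; set y2 := dotp T2 z2.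
move=> b1 b2.
have : 0 <= (1 - t) * (x1 - y1) + t * (x2 - y2)
  by rewrite addr_ge0 ?mulr_ge0 ?subr_ge0 // -subr_ge0.
by congr (0 <= _); ring.
Qed.

Variables (lin : 'cV[R]_N -> 'cV[R]_N) (zbar : 'cV[R]_N).
Variables (gamma r_z r_d : R) (zstar : 'cV[R]_N -> 'cV[R]_N).
Hypotheses (gamma_gt0 : 0 < gamma) (r_z_gt0 : 0 < r_z) (r_d_gt0 : 0 < r_d).
Hypothesis zstarP : forall d, eball 0 r_d d ->
  eball zbar r_z `&` gen_eq_sol (fun z => lin z - d) = [set zstar d].
Hypothesis zstar_lip : forall d d', eball 0 r_d d -> eball 0 r_d d' ->
  enorm (zstar d - zstar d') <= gamma * enorm (d - d').
Hypothesis zbar_sol : gen_eq_sol lin zbar.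

(** Since lin z - (lin z - G z) = G z, a solution for [G] solves the linearized equation perturbed
    by its own residual, and [zstar] selects that solution. *)
Lemma zstar_residual G z : eball zbar r_z z -> eball 0 r_d (lin z - G z) ->
  gen_eq_sol G z -> z = zstar (lin z - G z).
Proof.
move=> zr dr [u Nu G0].
have : (eball zbar r_z `&` gen_eq_sol (fun w => lin w - (lin z - G z))) z.
  by split=> //; exists u => //; rewrite subKr.
by rewrite zstarP.
Qed.

(** Solutions of two equations are compared through their residuals: with G1 = G2 this yields
    uniqueness, with different maps the error estimate. *)
Lemma gen_eq_sol_dist G1 G2 z1 z2 :
  eball zbar r_z z1 -> eball 0 r_d (lin z1 - G1 z1) -> gen_eq_sol G1 z1 ->
  eball zbar r_z z2 -> eball 0 r_d (lin z2 - G2 z2) -> gen_eq_sol G2 z2 ->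
  enorm (z1 - z2) <= gamma * enorm ((lin z1 - G1 z1) - (lin z2 - G2 z2)).
Proof.
move=> b1 d1 s1 b2 d2 s2.
rewrite {1}(zstar_residual _ _ b1 d1 s1) {1}(zstar_residual _ _ b2 d2 s2).
exact: zstar_lip.
Qed.

Lemma zstar0 : zstar 0 = zbar.
Proof.
have d0 : eball (0 : 'cV[R]_N) r_d 0 by rewrite /eball /= subr0 enorm0.
suff : (eball zbar r_z `&` gen_eq_sol (fun z => lin z - 0)) zbar by rewrite zstarP.
split; first by rewrite /eball /= subrr enorm0.
by case: zbar_sol => u Nu E; exists u => //; rewrite subr0.
Qed.

Lemma gen_eq_sol_dist_bar G z :
  eball zbar r_z z -> eball 0 r_d (lin z - G z) -> gen_eq_sol G z ->
  enorm (z - zbar) <= gamma * enorm (lin z - G z).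
Proof.
move=> b d s; rewrite {1}(zstar_residual _ _ b d s) -zstar0 -[X in gamma * enorm X]subr0.
by apply: zstar_lip => //; rewrite /eball /= subr0 enorm0.
Qed.

(* A solution is a fixed point of z |-> zstar (lin z - G z). *)
Lemma gen_eq_sol_exists G s : 0 < s -> s < r_z -> s < gamma * r_d ->
  continuous (fun z => lin z - G z) ->
  (forall z, enorm (z - zbar) <= s -> gamma * enorm (lin z - G z) <= s) ->
  exists2 z, enorm (z - zbar) <= s & gen_eq_sol G z.
Proof.
move=> s0 srz srd rc Hs.
have dr z : enorm (z - zbar) <= s -> eball 0 r_d (lin z - G z).
  move=> zs; rewrite /eball /= subr0 -(ltr_pM2l gamma_gt0).
  exact: le_lt_trans (Hs z zs) srd.
have [||z zs fz] := @Brouwer_ball R N (fun z => zstar (lin z - G z)) zbar s s0.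
- apply: (@enorm_lipschitz_continuous _ _ _ _ _
    ((fun z => lin z - G z) \o ball_retract zbar s) gamma) => [x y|x].
    by apply: zstar_lip; apply: dr; exact: ball_retract_le.
  by apply: continuous_comp; [exact: ball_retract_continuous|exact: rc].
- move=> z zs; rewrite -[X in _ - X]zstar0; apply: le_trans (Hs z zs).
  rewrite -[X in gamma * enorm X]subr0; apply: zstar_lip; first exact: dr.
  by rewrite /eball /= subr0 enorm0.
exists z => //.
have : [set zstar (lin z - G z)] z by rewrite /= fz.
rewrite -zstarP; last exact: dr.
by case=> _ [u Nu E]; exists u => //; rewrite -[G z](subKr (lin z)).
Qed.

End GeneralizedEquation.

(** * Convexity and uniqueness in balls *)

Lemma eball_convex {R : realType} {N : nat} (a x y : 'cV[R]_N) (r t : R) :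
  enorm (x - a) <= r -> enorm (y - a) <= r -> 0 <= t <= 1 ->
  enorm (x + t *: (y - x) - a) <= r.
Proof.
move=> xr yr /andP[t0 t1].
have -> : x + t *: (y - x) - a = (1 - t) *: (x - a) + t *: (y - a).
  by apply/colP => i; rewrite !mxE; ring.
apply: le_trans (enormD _ _) _; rewrite !enormZ !ger0_norm ?subr_ge0 //.
nra.
Qed.

(** A point of the segment from [z0] to [z], close to but distinct from [z0] unless z = z0, lies in
    both [S] and the open ball. *)
Lemma convex_unique_in_ball {R : realType} {N : nat} (S : set 'cV[R]_N) a r z0 z :
  (forall x y t, S x -> S y -> 0 <= t <= 1 -> S (x + t *: (y - x))) ->
  S `&` eball a r = [set z0] -> S z -> z = z0.
Proof.
move=> Sc S1 Sz.
have [Sz0 z0r] : (S `&` eball a r) z0 by rewrite S1.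
set d := r - enorm (z0 - a); have d0 : 0 < d by rewrite subr_gt0.
have D0 := enorm_ge0 (z - z0); set D := enorm (z - z0) in D0.
have dD : 0 < d + D by rewrite ltr_wpDr.
(* This choice gives t D < d, and the denominator is positive even when D = 0. *)
set t := d / (d + D).
have t0 : 0 < t by rewrite divr_gt0.
have t1 : t <= 1 by rewrite ler_pdivrMr // mul1r lerDl.
have : (S `&` eball a r) (z0 + t *: (z - z0)).
  split; first by apply: Sc => //; rewrite (ltW t0).
  rewrite /eball /= addrAC; apply: le_lt_trans (enormD _ _) _.
  rewrite enormZ ger0_norm ?(ltW t0) // -ltrBrDl -/d -/D.
  by rewrite mulrAC ltr_pdivrMr // ltr_pM2l // ltrDr.
rewrite S1 /= => /eqP; rewrite addrC -subr_eq0 addrK scaler_eq0 gt_eqF //= subr_eq0.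
by move/eqP.
Qed.

(** * Monotonicity of the subproblem *)

Lemma coneK_convex {R : realType} {n m : nat} (Omega : set 'cV[R]_n) (x y : 'cV[R]_(n + m)) t :
  convex_set Omega -> coneK Omega x -> coneK Omega y -> 0 <= t <= 1 ->
  coneK Omega (x + t *: (y - x)).
Proof.
move=> Oc Kx Ky /andP[t0 t1]; rewrite /coneK /=.
have := Oc (usubmx y) (usubmx x) (Itv01 t0 t1).
rewrite !inE => /(_ Ky Kx); congr Omega.
apply/colP => i; rewrite !mxE /=; rewrite /unstable.onem; ring.
Qed.

Lemma dotp_trmx {R : realType} {m n : nat} (A : 'M[R]_(m, n)) u v :
  dotp u (A *m v) = dotp (A^T *m u) v.
Proof.
have tr k (a b : 'cV[R]_k) : dotp a b = (a^T *m b) 0 0.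
  by rewrite mxE; apply: eq_bigr => i _; rewrite mxE.
by rewrite !tr trmx_mul trmxK mulmxA.
Qed.

(* The y-component of K is the whole space, so the sign of the second block
   of the generalized equation is immaterial; with the flipped sign the
   subproblem becomes monotone. *)
Definition dual_flip {R : realType} {n m : nat} : 'M[R]_(n + m) :=
  block_mx 1%:M 0 0 (- 1%:M).

Section Subproblem.
Context {R : realType} {n m : nat}.
Variable Omega : set 'cV[R]_n.
Local Notation K := (@coneK R n m Omega).

Lemma dual_flip_col (a : 'cV[R]_n) (b : 'cV[R]_m) :
  dual_flip *m col_mx a b = col_mx a (- b).
Proof. by rewrite mul_block_col !mul0mx mulNmx !mul1mx addr0 add0r. Qed.

Lemma dotp_col_mx (a b : 'cV[R]_n) (a' b' : 'cV[R]_m) :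
  dotp (col_mx a a') (col_mx b b') = dotp a b + dotp a' b'.
Proof.
rewrite /dotp big_split_ord /=; congr (_ + _); apply: eq_bigr => i _;
  by rewrite ?col_mxEu ?col_mxEd.
Qed.

(** After the flip the off-diagonal blocks are A^T and -A; their contributions cancel and the
    quadratic form of [H] remains. *)
Lemma dual_flip_monotone (A : 'M[R]_(m, n)) H v :
  psd H -> 0 <= dotp v (dual_flip *m Ftilde' A H *m v).
Proof.
move=> [_ Hpos]; rewrite -(vsubmxK v) -mulmxA /Ftilde' mul_block_col dual_flip_col.
rewrite dotp_col_mx mul0mx addr0 dotpDr dotpNr.
by rewrite (dotp_trmx A) (dotpC (A^T *m _)) addrK.
Qed.

(** The dual variable is free, so the variational inequality can be tested along minus the dual
    block of [G z]. *)
Lemma gen_eq_sol_dual0 G z : gen_eq_sol K G z -> dsubmx (G z) = 0.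
Proof.
move=> /gen_eq_solP[Kz /(_ (z - col_mx 0 (dsubmx (G z))))].
rewrite addrAC subrr add0r => H; apply: dotp_eq0; apply/le_anti; rewrite dotp_ge0 andbT.
have : 0 <= dotp (G z) (- col_mx 0 (dsubmx (G z))).
  apply: H; rewrite /coneK /=; move: Kz; rewrite /coneK /=; congr Omega.
  by apply/colP => i; rewrite !mxE (unsplitK (inl i)) mxE subr0.
rewrite -[X in dotp X _]vsubmxK dotpNr dotp_col_mx oppr_ge0.
by rewrite [dotp (usubmx _) 0]big1 ?add0r // => i _; rewrite [X in _ * X]mxE mulr0.
Qed.

(** The flip changes only the dual block, which vanishes at solutions of either equation. *)
Lemma gen_eq_sol_flip G z :
  gen_eq_sol K G z <-> gen_eq_sol K (fun w => dual_flip *m G w) z.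
Proof.
have flip0 (w : 'cV[R]_(n + m)) : dsubmx w = 0 -> dual_flip *m w = w.
  move=> w0; have E : w = col_mx (usubmx w) 0 by rewrite -w0 vsubmxK.
  by rewrite {1}E dual_flip_col oppr0 -E.
have flipd (w : 'cV[R]_(n + m)) : dsubmx (dual_flip *m w) = - dsubmx w.
  by rewrite -{1}(vsubmxK w) dual_flip_col col_mxKd.
split=> s; have := gen_eq_sol_dual0 _ _ s.
  by move=> /flip0 G0; case: s => u Nu E; exists u => //; rewrite G0.
rewrite flipd => /eqP; rewrite oppr_eq0 => /eqP/flip0 G0.
by case: s => u Nu E; exists u => //; rewrite -G0.
Qed.

Lemma sub_gen_eq_sol_convex (q : 'cV[R]_(n + m)) A H x y t :
  convex_set Omega -> psd H ->
  gen_eq_sol K (fun w => q + Ftilde' A H *m w) x ->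
  gen_eq_sol K (fun w => q + Ftilde' A H *m w) y ->
  0 <= t <= 1 -> gen_eq_sol K (fun w => q + Ftilde' A H *m w) (x + t *: (y - x)).
Proof.
move=> Oc Hp /gen_eq_sol_flip sx /gen_eq_sol_flip sy t01; apply/gen_eq_sol_flip.
have E : (fun w => dual_flip *m (q + Ftilde' A H *m w)) =
    fun w => dual_flip *m q + dual_flip *m Ftilde' A H *m w.
  by apply: funext => w; rewrite mulmxDr mulmxA.
move: sx sy; rewrite E => sx sy.
apply: monotone_gen_eq_sol_convex => // [a b s Ka Kb s01|v].
  exact: coneK_convex.
exact: dual_flip_monotone.
Qed.

End Subproblem.

(** * Local analysis at a strongly regular KKT point *)

Section LocalAnalysis.
Context {R : realType} {n m p : nat}.
Variables (c : 'cV[R]_n) (g : 'cV[R]_n -> 'cV[R]_m) (M : 'M[R]_(m, p)).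
Variable Omega : set 'cV[R]_n.
Hypothesis Omega_convex : convex_set Omega.
Hypothesis g_diff2 : twice_differentiable g.
Variables (gamma rbar_z rbar_delta : R) (xi : 'cV[R]_p) (zbar : 'cV[R]_(n + m)).
Hypothesis zbar_KKT : KKT c g M Omega xi zbar.
Hypothesis sreg : strongly_regular c g M Omega gamma rbar_z rbar_delta xi zbar.

Local Notation F := (kktF c g).
Local Notation J := (jac (kktF c g) zbar).
Local Notation C := (paramC M : 'M[R]_(n + m, p)).
Local Notation K := (@coneK R n m Omega).

Let lin z := F zbar + J *m (z - zbar) + C *m xi.

(** The margin in 2 gamma kappa < 1 is [mu]. After multiplication by [gamma], the first-order
    remainder costs at most mu/2 times the distance to [zbar], and the parameter shift at most
    (mu/4) r. *)
Variables (kappa mu eps CB r r_xi : R).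
Hypothesis kappa_ge0 : 0 <= kappa.
Hypothesis muE : mu = 1 - 2 * gamma * kappa.
Hypothesis mu_gt0 : 0 < mu.
Hypothesis epsE : gamma * eps = mu / 2.
Hypothesis CB_ge0 : 0 <= CB.
Hypothesis CBP : forall v, enorm (C *m v) <= CB * enorm v.
Hypothesis r_gt0 : 0 < r.
Hypothesis r_le_z : r <= rbar_z.
Hypothesis r_le_delta : r <= gamma * rbar_delta.
Hypothesis r_littleo : forall z, eball zbar r z ->
  enorm (F z - F zbar - J *m (z - zbar)) <= eps * enorm (z - zbar).
Hypothesis r_xi_le : gamma * CB * r_xi <= mu / 4 * r.

Let gamma_gt0 : 0 < gamma. Proof. by case: sreg. Qed.

Let subG zk A H xi1 z := F zk + Ftilde' A H *m (z - zk) + C *m xi1.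

Let sub_gen zk A H xi1 :
  sub_KKT c g M Omega zk A H xi1 = gen_eq_sol K (subG zk A H xi1).
Proof. by []. Qed.

Let mu_le1 : mu <= 1.
Proof. have := mulr_ge0 (ltW gamma_gt0) kappa_ge0; rewrite muE; lra. Qed.

Let lin_sol : gen_eq_sol K lin zbar.
Proof.
have [u Nu E] := zbar_KKT; exists u => //.
by rewrite /lin subrr mulmx0 addr0.
Qed.

Let shift_small xi1 : eball xi r_xi xi1 -> gamma * (CB * enorm (xi1 - xi)) <= mu / 4 * r.
Proof.
rewrite /eball /= => h; apply: le_trans r_xi_le; rewrite -mulrA ler_pM2l //.
by rewrite ler_wpM2l // ltW.
Qed.

Let selection : exists zstar : 'cV[R]_(n + m) -> 'cV[R]_(n + m),
  (forall d, eball 0 rbar_delta d ->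
     eball zbar rbar_z `&` gen_eq_sol K (fun z => lin z - d) = [set zstar d]) /\
  (forall d d', eball 0 rbar_delta d -> eball 0 rbar_delta d' ->
     enorm (zstar d - zstar d') <= gamma * enorm (d - d')).
Proof.
have [_ _ _ [zstar [h1 h2]]] := sreg; exists zstar; split=> // d dr.
rewrite -h1 //; congr (_ `&` _); apply/seteqP; split=> z [u Nu E]; exists u => //.
  by apply/eqP; rewrite -subr_eq0 -oppr_eq0 opprB addrAC -E.
by rewrite addrAC -/(lin z) [X in _ = X - d](_ : _ = d) ?subrr // E.
Qed.

Lemma KKT_residual_le xi1 z : eball zbar r z ->
  gamma * enorm (lin z - (F z + C *m xi1)) <=
    mu / 2 * enorm (z - zbar) + gamma * (CB * enorm (xi1 - xi)).
Proof.
move=> zr; rewrite -epsE -mulrA -mulrDr ler_pM2l //.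
have -> : lin z - (F z + C *m xi1) =
    - (F z - F zbar - J *m (z - zbar)) - C *m (xi1 - xi).
  rewrite /lin [C *m (_ - _)]mulmxBr; move: (J *m _) (C *m _) (C *m xi) => a b d.
  by apply/colP => i; rewrite !mxE; ring.
apply: le_trans (enormD _ _) _; rewrite !enormN lerD ?CBP //.
exact: r_littleo.
Qed.

(** The residual consists of the matrix error at z - zbar, the matrix error and first-order
    remainder at zk - zbar, and the parameter shift. *)
Lemma sub_residual_le A H zk xi1 z : opnorm (J - Ftilde' A H) <= kappa ->
  eball zbar r zk ->
  gamma * enorm (lin z - subG zk A H xi1 z) <=
    gamma * kappa * enorm (z - zbar) + (gamma * kappa + mu / 2) * enorm (zk - zbar)
    + gamma * (CB * enorm (xi1 - xi)).
Proof.
move=> JF zr; rewrite -epsE -mulrDr -!mulrA -!mulrDr ler_pM2l //.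
have -> : lin z - subG zk A H xi1 z =
    (J - Ftilde' A H) *m (z - zbar)
    - ((J - Ftilde' A H) *m (zk - zbar) + (F zk - F zbar - J *m (zk - zbar)))
    - C *m (xi1 - xi).
  rewrite /lin /subG !mulmxBl !mulmxBr; apply/colP => i; rewrite !mxE; ring.
have op w : enorm ((J - Ftilde' A H) *m w) <= kappa * enorm w.
  by apply: le_trans (opnormP _ _) _; rewrite ler_wpM2r ?enorm_ge0.
apply: le_trans (enormD _ _) _; rewrite enormN lerD ?CBP //.
apply: le_trans (enormD _ _) _; rewrite enormN lerD ?op // mulrDl.
by apply: le_trans (enormD _ _) _; rewrite lerD ?op // r_littleo.
Qed.

Let residual_ball (w : 'cV[R]_(n + m)) : gamma * enorm w < r -> eball 0 rbar_delta w.
Proof.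
move=> h; rewrite /eball /= subr0 -(ltr_pM2l gamma_gt0).
exact: lt_le_trans h r_le_delta.
Qed.

Let ball_le z : eball zbar r z -> eball zbar rbar_z z.
Proof. by move=> zr; exact: lt_le_trans zr r_le_z. Qed.

Let KKT_residual_ball xi1 z : eball zbar r z -> eball xi r_xi xi1 ->
  eball 0 rbar_delta (lin z - (F z + C *m xi1)).
Proof.
move=> zr xir; apply: residual_ball; apply: le_lt_trans (KKT_residual_le xi1 z zr) _.
have := shift_small xi1 xir.
have : mu / 2 * enorm (z - zbar) <= mu / 2 * r by rewrite ler_wpM2l ?divr_ge0 ?ltW.
have : mu * r <= r by rewrite ler_piMl // ltW.
have := r_gt0; lra.
Qed.

Let sub_residual_ball A H zk xi1 z : opnorm (J - Ftilde' A H) <= kappa ->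
  eball zbar r zk -> eball zbar r z -> eball xi r_xi xi1 ->
  eball 0 rbar_delta (lin z - subG zk A H xi1 z).
Proof.
move=> JF zkr zr xir; apply: residual_ball.
apply: le_lt_trans (sub_residual_le A H zk xi1 z JF zkr) _.
have := shift_small xi1 xir.
have gk0 : 0 <= gamma * kappa by rewrite mulr_ge0 // ltW.
have : gamma * kappa * enorm (z - zbar) <= gamma * kappa * r by rewrite ler_wpM2l // ltW.
have : (gamma * kappa + mu / 2) * enorm (zk - zbar) <= (gamma * kappa + mu / 2) * r.
  by rewrite ler_wpM2l ?addr_ge0 ?divr_ge0 ?(ltW mu_gt0) ?(ltW zkr).
have : 0 < mu * r by rewrite mulr_gt0.
(* The coefficients gamma kappa, gamma kappa + mu/2 and mu/4 of [r] add up to 1 - mu/4 < 1. *)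
have -> : gamma * kappa = (1 - mu) / 2 by rewrite muE; field.
lra.
Qed.

Let lin_continuous : continuous lin.
Proof.
apply: (@enorm_lipschitz_continuous _ _ _ _ lin id (opnorm J)) => [x y|x]; last exact: cvg_id.
have -> : lin x - lin y = J *m (x - y).
  by rewrite /lin !mulmxBr; apply/colP => i; rewrite !mxE; ring.
exact: opnormP.
Qed.

Let solution_exists G s : 0 < s -> s < r -> continuous (fun z => lin z - G z) ->
  (forall z, enorm (z - zbar) <= s -> gamma * enorm (lin z - G z) <= s) ->
  exists2 z, enorm (z - zbar) <= s & gen_eq_sol K G z.
Proof.
move=> s0 sr; have [zstar [zP zL]] := selection.
have rd0 : 0 < rbar_delta by case: sreg.
apply: (gen_eq_sol_exists K lin zbar gamma rbar_z rbar_delta zstar) => //.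
- exact: lt_le_trans r_gt0 r_le_z.
- exact: lt_le_trans sr r_le_z.
- exact: lt_le_trans sr r_le_delta.
Qed.

Let solution_dist G1 G2 z1 z2 :
  eball zbar r z1 -> eball 0 rbar_delta (lin z1 - G1 z1) -> gen_eq_sol K G1 z1 ->
  eball zbar r z2 -> eball 0 rbar_delta (lin z2 - G2 z2) -> gen_eq_sol K G2 z2 ->
  enorm (z1 - z2) <= gamma * enorm ((lin z1 - G1 z1) - (lin z2 - G2 z2)).
Proof.
move=> b1 d1 s1 b2 d2 s2; have [zstar [zP zL]] := selection.
by apply: (gen_eq_sol_dist K lin zbar gamma rbar_z rbar_delta zstar) => //; exact: ball_le.
Qed.

(** On the closed ball of radius r/2, remainder and shift each cost at most (mu/4) r, together at
    most r/2. *)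
Lemma KKT_exists xi1 : eball xi r_xi xi1 ->
  exists2 z, eball zbar r z & KKT c g M Omega xi1 z.
Proof.
move=> xir; have r2 : r / 2 < r by rewrite ltr_pdivrMr // ltr_pMr // ltr1n.
have [||z|z zs sol] := solution_exists (fun z => F z + C *m xi1) (r / 2) _ r2.
- by rewrite divr_gt0.
- move=> z; apply: (@cvgB _ _ _ (nbhs z) _); first exact: lin_continuous.
  apply: (@cvgD _ _ _ (nbhs z) _); first exact: kktF_continuous.
  exact: (@cvg_cst _ _ _ (nbhs z) _).
- move=> zs; apply: le_trans (KKT_residual_le xi1 z (le_lt_trans zs r2)) _.
  have := shift_small xi1 xir.
  have : mu / 2 * enorm (z - zbar) <= mu / 2 * (r / 2).
    by rewrite ler_wpM2l ?divr_ge0 ?(ltW mu_gt0).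
  have : mu * r <= r by rewrite ler_piMl // ltW.
  lra.
by exists z => //; exact: le_lt_trans zs r2.
Qed.

(** The remainder term is absorbed on the left, where mu <= 1 leaves a factor of at least 1/2; hence
    the constant 2. *)
Lemma KKT_dist xi1 z : eball xi r_xi xi1 -> eball zbar r z ->
  KKT c g M Omega xi1 z ->
  enorm (z - zbar) <= 2 * gamma * CB * enorm (xi1 - xi).
Proof.
move=> xir zr sol; have [zstar [zP zL]] := selection.
have rd0 : 0 < rbar_delta by case: sreg.
have rz0 := lt_le_trans r_gt0 r_le_z.
have := gen_eq_sol_dist_bar K lin zbar gamma rbar_z rbar_delta zstar
  rz0 rd0 zP zL lin_sol (fun z => F z + C *m xi1) z (ball_le z zr)
  (KKT_residual_ball xi1 z zr xir) sol.
move=> /le_trans/(_ (KKT_residual_le xi1 z zr)).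
have : mu * enorm (z - zbar) <= enorm (z - zbar) by rewrite ler_piMl ?enorm_ge0.
rewrite -!mulrA; lra.
Qed.

(** Residuals at x and y differ by (J - Ftilde')(x - y), so the distance of two solutions in the
    ball is at most gamma kappa < 1/2 times itself. *)
Lemma sub_unique A H zk xi1 : opnorm (J - Ftilde' A H) <= kappa ->
  eball zbar r zk -> eball xi r_xi xi1 ->
  exists z1, sub_KKT c g M Omega zk A H xi1 `&` eball zbar r = [set z1].
Proof.
(* The closed ball of radius [s] contains [zk], and s >= r/2 bounds the shift (mu/4) r by (mu/2) s,
   exactly what the other terms leave. *)
move=> JF zkr xir; set s := Num.max (enorm (zk - zbar)) (r / 2).
have r2 : r / 2 < r by rewrite ltr_pdivrMr // ltr_pMr // ltr1n.
have sr : s < r by rewrite gt_max zkr.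
have zks : enorm (zk - zbar) <= s by rewrite le_max lexx.
have rs : r / 2 <= s by rewrite le_max lexx orbT.
have s0 : 0 < s by apply: lt_le_trans rs; rewrite divr_gt0.
have resB x y : (lin x - subG zk A H xi1 x) - (lin y - subG zk A H xi1 y) =
    (J - Ftilde' A H) *m (x - y).
  by rewrite /lin /subG !mulmxBl !mulmxBr; apply/colP => i; rewrite !mxE; ring.
have gk0 : 0 <= gamma * kappa by rewrite mulr_ge0 // ltW.
have gkE : gamma * kappa = (1 - mu) / 2 by rewrite muE; field.
have [||z zs sol] := solution_exists (subG zk A H xi1) s s0 sr.
- apply: (@enorm_lipschitz_continuous _ _ _ _ _ id (opnorm (J - Ftilde' A H))).
    by move=> x y; rewrite resB; exact: opnormP.
  by move=> x; exact: cvg_id.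
- move=> z zs; apply: le_trans (sub_residual_le A H zk xi1 z JF zkr) _.
  have := shift_small xi1 xir.
  have : gamma * kappa * enorm (z - zbar) <= gamma * kappa * s by rewrite ler_wpM2l.
  have : (gamma * kappa + mu / 2) * enorm (zk - zbar) <= (gamma * kappa + mu / 2) * s.
    by rewrite ler_wpM2l ?addr_ge0 ?divr_ge0 ?(ltW mu_gt0).
  have : mu * (r / 2) <= mu * s by rewrite ler_wpM2l // ltW.
  rewrite gkE; lra.
have zr := le_lt_trans zs sr.
exists z; apply/seteqP; split=> [w [ws wr]|_ ->]; last by split.
have := solution_dist (subG zk A H xi1) (subG zk A H xi1) _ _ wr
  (sub_residual_ball A H zk xi1 w JF zkr wr xir) ws
  zr (sub_residual_ball A H zk xi1 z JF zkr zr xir) sol.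
rewrite resB => h; apply/eqP; rewrite -subr_eq0; apply/eqP/enorm_eq0/le_anti.
rewrite enorm_ge0 andbT.
have : gamma * enorm ((J - Ftilde' A H) *m (w - z)) <= gamma * (kappa * enorm (w - z)).
  by rewrite ler_pM2l //; apply: le_trans (opnormP _ _) _; rewrite ler_wpM2r ?enorm_ge0.
move=> /(le_trans h); rewrite mulrA gkE.
have := enorm_ge0 (w - z); have := mu_gt0; nra.
Qed.

(** The segment stays in the ball of radius [rho], where the derivative differs from its value at
    [zbar] by at most w rho. *)
Lemma strict_derivative w rho x y : 0 <= w ->
  (forall z, eball zbar r z -> opnorm (jac F z - J) <= w * enorm (z - zbar)) ->
  enorm (x - zbar) <= rho -> enorm (y - zbar) <= rho -> rho < r ->
  enorm (F y - F x - J *m (y - x)) <= w * rho * enorm (y - x).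
Proof.
move=> w0 Hw xr yr rr; apply: jac_mean_value => [z|t t01].
  exact: kktF_differentiable.
have zr := eball_convex _ _ _ _ _ xr yr t01.
apply: le_trans (Hw _ (le_lt_trans zr rr)) _.
by rewrite ler_wpM2l.
Qed.

(** The parameter terms cancel in the difference of the residuals, and the rest contributes at most
    half the distance of the two points. *)
Lemma KKT_unique w xi1 : 0 <= w -> gamma * w * r <= 2^-1 ->
  (forall z, eball zbar r z -> opnorm (jac F z - J) <= w * enorm (z - zbar)) ->
  eball xi r_xi xi1 ->
  exists zbar1, KKT c g M Omega xi1 `&` eball zbar r = [set zbar1].
Proof.
move=> w0 wr Hw xir; have [z zr sol] := KKT_exists xi1 xir.
exists z; apply/seteqP; split=> [z' [sol' zr']|_ ->]; last by split.
have := solution_dist (fun z => F z + C *m xi1) (fun z => F z + C *m xi1) _ _ zr'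
  (KKT_residual_ball xi1 z' zr' xir) sol'
  zr (KKT_residual_ball xi1 z zr xir) sol.
have -> : lin z' - (F z' + C *m xi1) - (lin z - (F z + C *m xi1)) =
    - (F z' - F z - J *m (z' - z)).
  by rewrite /lin !mulmxBr; apply/colP => i; rewrite !mxE; ring.
rewrite enormN => h; apply/eqP; rewrite -subr_eq0; apply/eqP/enorm_eq0/le_anti.
rewrite enorm_ge0 andbT; set rho := Num.max (enorm (z - zbar)) (enorm (z' - zbar)).
have rr : rho < r by rewrite gt_max zr.
have z1 : enorm (z - zbar) <= rho by rewrite le_max lexx.
have z2 : enorm (z' - zbar) <= rho by rewrite le_max lexx orbT.
have := strict_derivative w rho z z' w0 Hw z1 z2 rr.
rewrite -(ler_pM2l gamma_gt0) => /(le_trans h); rewrite !mulrA.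
have : gamma * w * rho <= 2^-1.
  by apply: le_trans wr; rewrite ler_wpM2l ?mulr_ge0 // ltW.
have := enorm_ge0 (z' - z); nra.
Qed.

(** The residual difference contains (J - Ftilde')(z1 - zbar1), absorbed on the left; the remaining
    terms involve zbar1 - zk, estimated through [zbar]. *)
Lemma sub_KKT_dist w A H zk xi1 z1 zbar1 : 0 <= w ->
  (forall z, eball zbar r z -> opnorm (jac F z - J) <= w * enorm (z - zbar)) ->
  psd H -> opnorm (J - Ftilde' A H) <= kappa -> eball zbar r zk -> eball xi r_xi xi1 ->
  sub_KKT c g M Omega zk A H xi1 z1 -> KKT c g M Omega xi1 zbar1 -> eball zbar r zbar1 ->
  (1 - gamma * kappa) * enorm (z1 - zbar1) <=
    gamma * kappa * (enorm (zk - zbar) + enorm (zbar1 - zbar))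
    + gamma * w * (enorm (zk - zbar) + enorm (zbar1 - zbar)) ^+ 2.
Proof.
move=> w0 Hw Hp JF zkr xir sol1 solbar zbr.
have [z0 z0E] := sub_unique A H zk xi1 JF zkr xir.
have qE : subG zk A H xi1 =
    fun z => (F zk - Ftilde' A H *m zk + C *m xi1) + Ftilde' A H *m z.
  apply: funext => z; rewrite /subG mulmxBr.
  by apply/colP => i; rewrite !mxE; ring.
(* Convexity of the solution set places the iterate in the ball. *)
have z1E : z1 = z0.
  apply: (convex_unique_in_ball _ _ _ _ _ _ z0E sol1) => x y t.
  rewrite sub_gen qE; exact: sub_gen_eq_sol_convex.
have [_ z1r] : (sub_KKT c g M Omega zk A H xi1 `&` eball zbar r) z1 by rewrite z0E.
have := solution_dist (subG zk A H xi1) (fun z => F z + C *m xi1) _ _ z1r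
  (sub_residual_ball A H zk xi1 z1 JF zkr z1r xir) sol1
  zbr (KKT_residual_ball xi1 zbar1 zbr xir) solbar.
have -> : lin z1 - subG zk A H xi1 z1 - (lin zbar1 - (F zbar1 + C *m xi1)) =
    (J - Ftilde' A H) *m (z1 - zbar1)
    + ((J - Ftilde' A H) *m (zbar1 - zk) + (F zbar1 - F zk - J *m (zbar1 - zk))).
  by rewrite /lin /subG !mulmxBl !mulmxBr; apply/colP => i; rewrite !mxE; ring.
set rho := Num.max (enorm (zk - zbar)) (enorm (zbar1 - zbar)).
have rr : rho < r by rewrite gt_max zkr.
have e1 : enorm (zk - zbar) <= rho by rewrite le_max lexx.
have e2 : enorm (zbar1 - zbar) <= rho by rewrite le_max lexx orbT.
have a0 := enorm_ge0 (zk - zbar); have b0 := enorm_ge0 (zbar1 - zbar).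
have e3 : rho <= enorm (zk - zbar) + enorm (zbar1 - zbar).
  by rewrite ge_max lerDl lerDr a0 b0.
have op v : enorm ((J - Ftilde' A H) *m v) <= kappa * enorm v.
  by apply: le_trans (opnormP _ _) _; rewrite ler_wpM2r ?enorm_ge0.
move=> /le_trans H1; have {H1} := H1 (gamma * (kappa * enorm (z1 - zbar1) +
  (kappa * enorm (zbar1 - zk) + w * rho * enorm (zbar1 - zk)))).
rewrite ler_pM2l // => H1.
have {}H1 := H1 (le_trans (enormD _ _) (lerD (op _) (le_trans (enormD _ _)
  (lerD (op _) (strict_derivative w rho zk zbar1 w0 Hw e1 e2 rr))))).
have y1 : enorm (zbar1 - zk) <= enorm (zk - zbar) + enorm (zbar1 - zbar).
  by rewrite [leRHS]addrC (edistC zk); exact: edistD.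
have k1 : kappa * enorm (zbar1 - zk) <= kappa * (enorm (zk - zbar) + enorm (zbar1 - zbar)).
  by rewrite ler_wpM2l.
have k2 : w * rho * enorm (zbar1 - zk) <=
    w * (enorm (zk - zbar) + enorm (zbar1 - zbar)) ^+ 2.
  rewrite -mulrA ler_wpM2l // expr2 ler_pM ?enorm_ge0 //.
  exact: le_trans e1.
have := lerD k1 k2; rewrite -(ler_pM2l gamma_gt0) => k3; lra.
Qed.


End LocalAnalysis.

(** * Choice of constants and radii, and the final estimate *)

Theorem theorem3p4 (R : realType) (n m p : nat)
  (c : 'cV[R]_n) (g : 'cV[R]_n -> 'cV[R]_m) (M : 'M[R]_(m, p))
  (Omega : set 'cV[R]_n) (Par : set 'cV[R]_p)
  (Omega_nonempty : Omega !=set0)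
  (Omega_closed : closed Omega)
  (Omega_convex : convex_set Omega)
  (g_diff2 : twice_differentiable g)
  (xi0 : 'cV[R]_p) (Par_xi0 : Par xi0) (KKT_xi0 : KKT c g M Omega xi0 !=set0)
  (gamma rbar_z rbar_delta : R)
  (gamma_gt0 : 0 < gamma) (rbar_z_gt0 : 0 < rbar_z)
  (rbar_delta_gt0 : 0 < rbar_delta)
  (kappa : R) (kappa_bound : 0 <= kappa < (2 * gamma)^-1) :
  exists (alpha : R) (c1 c2 c3 : R -> R),
    [/\ 0 <= alpha < 1,
        forall omega, 0 <= omega ->
          [/\ 0 <= c1 omega, 0 < c2 omega & 0 <= c3 omega] &
    forall (k : nat) (xik : 'cV[R]_p) (zbark : 'cV[R]_(n + m)),
      Par xik ->
      KKT c g M Omega xik zbark ->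
      strongly_regular c g M Omega gamma rbar_z rbar_delta xik zbark ->
      exists r_z r_xi : R,
      [/\ 0 < r_z /\ 0 < r_xi,
      (* (a) *)
        forall xi1, eball xik r_xi xi1 -> KKT c g M Omega xi1 !=set0,
      (* (b) *)
        forall (Ak : 'M[R]_(m, n)) (Hk : 'M[R]_n) (zk : 'cV[R]_(n + m))
            (xi1 : 'cV[R]_p),
          psd Hk ->
          opnorm (jac (kktF c g) zbark - Ftilde' Ak Hk) <= kappa ->
          coneK Omega zk -> eball zbark r_z zk ->
          eball xik r_xi xi1 ->
          slater g M Omega zk Ak xi1 ->
          exists z1, sub_KKT c g M Omega zk Ak Hk xi1 `&` eball zbark r_z
                     = [set z1] &
      (* (c) *)
        forall omega : R, 0 <= omega ->
          (forall z, eball zbark r_z z ->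
            opnorm (jac (kktF c g) z - jac (kktF c g) zbark)
              <= omega * enorm (z - zbark)) ->
          forall (xi : nat -> 'cV[R]_p) (z : nat -> 'cV[R]_(n + m))
              (A : nat -> 'M[R]_(m, n)) (H : nat -> 'M[R]_n),
            APCSCP c g M Omega Par k xi z A H ->
            (forall j, (j <= k)%N -> slater g M Omega (z j) (A j) (xi j.+1)) ->
            xi 0%N = xi0 -> xi k = xik ->
            opnorm (jac (kktF c g) zbark - Ftilde' (A k) (H k)) <= kappa ->
            eball zbark r_z (z k) ->
            eball xik r_xi (xi k.+1) ->
            exists zbark1,
              KKT c g M Omega (xi k.+1) `&` eball zbark r_z = [set zbark1] /\
              enorm (z k.+1 - zbark1)
                <= (alpha + c1 omega * enorm (z k - zbark))
                     * enorm (z k - zbark)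
                 + (c2 omega + c3 omega * enorm (xi k.+1 - xi k))
                     * enorm (xi k.+1 - xi k)]].
Proof.
have /andP[kappa_ge0 kappa_lt] := kappa_bound.
have gk0 : 0 <= gamma * kappa by rewrite mulr_ge0 // ltW.
have gk1 : 2 * (gamma * kappa) < 1.
  by move: kappa_lt; rewrite -[_^-1]mul1r ltr_pdivlMr ?mulr_gt0 // mulrC mulrA.
have d0 : 0 < 1 - gamma * kappa by lra.
have [CB CB0 CBP] := enorm_mulmx_bounded (paramC M : 'M[R]_(n + m, p)).
(* Dividing by the absorbed factor 1 - gamma kappa gives alpha < 1 exactly when 2 gamma kappa <
   1. *)
pose alpha := gamma * kappa / (1 - gamma * kappa).
pose L := 2 * gamma * CB.
pose a w := gamma * w / (1 - gamma * kappa).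
have alpha0 : 0 <= alpha by rewrite divr_ge0 // ltW.
have L0 : 0 <= L by rewrite !mulr_ge0 // ltW.
have a0 w : 0 <= w -> 0 <= a w.
  by move=> w0; rewrite divr_ge0 ?(ltW d0) // mulr_ge0 // ltW.
(* The factors 2 come from squaring a sum; the added 1 makes [c2] positive even when alpha L = 0. *)
exists alpha, (fun w => 2 * a w), (fun=> alpha * L + 1), (fun w => 2 * a w * L ^+ 2).
split=> [|w w0|k xik zbark _ zbar_KKT sreg].
- rewrite alpha0 /= ltr_pdivrMr //; lra.
- have := a0 w w0; move: (a w) => b b0; split.
  + by rewrite mulr_ge0.
  + by rewrite ltr_wpDl // mulr_ge0.
  + exact: mulr_ge0 (mulr_ge0 _ b0) (exprn_ge0 2 L0).
pose mu := 1 - 2 * gamma * kappa.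
have mu0 : 0 < mu by rewrite /mu -mulrA subr_gt0.
pose eps := mu / 2 / gamma.
have eps0 : 0 < eps by rewrite !divr_gt0.
have epsE : gamma * eps = mu / 2 by rewrite /eps mulrC divfK // gt_eqF.
have [r1 r1_gt0 r1P] := jac_littleo _ zbark (kktF_differentiable c g g_diff2 zbark) _ eps0.
pose lip w r := 0 <= w /\ forall z, eball zbark r z ->
  opnorm (jac (kktF c g) z - jac (kktF c g) zbark) <= w * enorm (z - zbark).
(* The radius must be chosen before omega: if the Lipschitz condition holds on
   no ball at all, then (c) is vacuous; otherwise fix one instance (w0, r0). *)
have [w0 [r0 [r0_gt0 w0_ge0 lip0]]] : exists w0 r0 : R, [/\ 0 < r0, 0 <= w0 &
    forall w r, 0 < r -> lip w r -> lip w0 r0].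
  have [[w0 [r0 [r0_gt0 h]]]|none] := pselect (exists w0 r0, 0 < r0 /\ lip w0 r0).
    by exists w0, r0; split=> //; case: h.
  exists 0, 1; split=> // w r r_gt0 h; exfalso; apply: none.
  by exists w, r.
(* Chosen so that gamma (w0 + 1) r2 = 1/2; w0 + 1 is positive even when w0 = 0. *)
pose r2 := (2 * gamma * (w0 + 1))^-1.
have w1 : 0 < w0 + 1 by rewrite ltr_wpDl.
have r2_gt0 : 0 < r2 by rewrite invr_gt0 !mulr_gt0.
pose r := Num.min (Num.min r1 rbar_z) (Num.min (gamma * rbar_delta) (Num.min r0 r2)).
have r_gt0 : 0 < r by rewrite !lt_min r1_gt0 rbar_z_gt0 r0_gt0 r2_gt0 mulr_gt0.
have [rr1 rrz rrd rr0 rr2] : [/\ r <= r1, r <= rbar_z, r <= gamma * rbar_delta,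
    r <= r0 & r <= r2].
  by split; rewrite /r !ge_min lexx ?orbT.
have wr : gamma * w0 * r <= 2^-1.
  apply: (@le_trans _ _ (gamma * (w0 + 1) * r2)).
    by apply: ler_pM; rewrite ?mulr_ge0 ?(ltW gamma_gt0) ?(ltW r_gt0) // ler_pM2l // lerDl.
  by rewrite /r2 -[2 * gamma * _]mulrA invfM mulrCA mulfV ?mulr1 // gt_eqF ?mulr_gt0.
pose r_xi := mu / 4 * r / (gamma * (CB + 1)).
have CB1 : 0 < CB + 1 by rewrite ltr_wpDl.
have r_xi_gt0 : 0 < r_xi by rewrite divr_gt0 ?mulr_gt0.
have r_xi_le : gamma * CB * r_xi <= mu / 4 * r.
  rewrite /r_xi mulrCA ger_pMr ?mulr_gt0 // ler_pdivrMr ?mulr_gt0 // mul1r.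
  by rewrite ler_pM2l // lerDl.
have r_o z : eball zbark r z -> enorm (kktF c g z - kktF c g zbark
    - jac (kktF c g) zbark *m (z - zbark)) <= eps * enorm (z - zbark).
  by move=> zr; apply: r1P; exact: lt_le_trans zr rr1.
exists r, r_xi; split=> // [xi1 xir|Ak Hk zk xi1 _ JF _ zkr xir _|].
- have [z _ sol] := KKT_exists c g M Omega g_diff2 gamma rbar_z rbar_delta xik zbark
    zbar_KKT sreg kappa mu eps CB r r_xi kappa_ge0 erefl mu0 epsE CB0 CBP
    r_gt0 rrz rrd r_o r_xi_le xi1 xir.
  by exists z.
- exact: (sub_unique c g M Omega gamma rbar_z rbar_delta xik zbark
    zbar_KKT sreg kappa mu eps CB r r_xi kappa_ge0 erefl mu0 epsE CB0 CBP
    r_gt0 rrz rrd r_o r_xi_le).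
move=> w w_ge0 Hw xi z A H [_ _ Hpsd /(_ k (leqnn k)) [_ sol]] _ _ xikE JF zkr xir.
rewrite xikE.
(* The Lipschitz hypothesis of (c) activates the fixed instance. Uniqueness uses [w0], to which the
   radius is adapted; the estimate keeps the given [w]. *)
have [w0_ge0' lip0'] : lip w0 r0 by exact: (lip0 w r).
have Hw0 y : eball zbark r y ->
    opnorm (jac (kktF c g) y - jac (kktF c g) zbark) <= w0 * enorm (y - zbark).
  by move=> yr; apply: lip0'; exact: lt_le_trans yr rr0.
have [zbar1 zbar1E] := KKT_unique c g M Omega g_diff2 gamma rbar_z rbar_delta xik zbark
    zbar_KKT sreg kappa mu eps CB r r_xi kappa_ge0 erefl mu0 epsE CB0 CBP
    r_gt0 rrz rrd r_o r_xi_le w0 (xi k.+1) w0_ge0 wr Hw0 xir.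
exists zbar1; split=> //.
have [zbar1_KKT zbar1r] : (KKT c g M Omega (xi k.+1) `&` eball zbark r) zbar1.
  by rewrite zbar1E.
have := KKT_dist c g M Omega gamma rbar_z rbar_delta xik zbark
    zbar_KKT sreg kappa mu eps CB r r_xi kappa_ge0 erefl mu0 epsE CB0 CBP
    r_gt0 rrz rrd r_o r_xi_le (xi k.+1) zbar1 xir zbar1r zbar1_KKT.
have := sub_KKT_dist c g M Omega Omega_convex g_diff2 gamma rbar_z rbar_delta xik zbark
    zbar_KKT sreg kappa mu eps CB r r_xi kappa_ge0 erefl mu0 epsE CB0 CBP
    r_gt0 rrz rrd r_o r_xi_le w (A k) (H k) (z k) (xi k.+1) (z k.+1) zbar1
    w_ge0 Hw (Hpsd k (leqnn k)) JF zkr xir sol zbar1_KKT zbar1r.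
have s0 := enorm_ge0 (z k - zbark); have t0 := enorm_ge0 (zbar1 - zbark).
have := enorm_ge0 (xi k.+1 - xik).
move: (enorm (z k.+1 - _)) (enorm (z k - _)) (enorm (zbar1 - _)) (enorm (xi _ - _))
  s0 t0 => x s t d s0 t0 d_ge0.
have -> : gamma * kappa * (s + t) + gamma * w * (s + t) ^+ 2 =
    (1 - gamma * kappa) * (alpha * (s + t) + a w * (s + t) ^+ 2).
  by rewrite /alpha /a; field; rewrite gt_eqF.
rewrite ler_pM2l // -/L => xle tle.
(* Splitting the square separates the previous error from the parameter change, as the form of the
   bound requires. *)
have st : (s + t) ^+ 2 <= 2 * s ^+ 2 + 2 * (L * d) ^+ 2.
  have : t ^+ 2 <= (L * d) ^+ 2 by rewrite ler_sqr ?nnegrE // mulr_ge0.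
  by have := sqr_ge0 (s - t); nra.
have := ler_wpM2l alpha0 tle; have := ler_wpM2l (a0 w w_ge0) st.
nra.
Qed.
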